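(* Let $\Phi(x)=\mathbb{E}_{\xi\sim\mathcal P}[\phi(x,\xi)]$ be $L$-smooth and g-convex, and assume $\max_{x\in\mathcal X,\ \xi\in\mathrm{supp}(\mathcal P)}\|\mathrm{grad}\,\phi(x,\xi)\|\le C$ for some constant $C\ge 0$. Run the algorithm SRFW (see context) from $x_0\in\mathcal X$ for $K\ge 1$ iterations with constant step sizes $\eta_k=\frac{1}{\sqrt K}$ and constant minibatch sizes $b_k=K$, and let $\hat x$ be its output. Then the optimality gap satisfies $$\mathbb{E}\left[\Phi(\hat x)-\Phi(x^* )\right]=O\left(\frac{1}{\sqrt K}\right),$$ where $x^*\in\operatorname{argmin}_{x\in\mathcal X}\Phi(x)$ and the implied constant depends on the problem data and $x_0$ but not on $K$.
   Context: Setting: $\mathcal M$ is a Riemannian manifold with inner products $\langle\cdot,\cdot\rangle_x$ and norms $\|\cdot\|_x$ on tangent spaces $T_x\mathcal M$ and geodesic distance $d$. For $x,y\in\mathcal M$, $\mathrm{Exp}_x^{-1}(y)\in T_x\mathcal M$ is the inverse exponential map; it is assumed to be well defined for all points considered, with $\|\mathrm{Exp}_x^{-1}(y)\|_x=d(x,y)$, and ''the geodesic $\gamma:[0,1]\to\mathcal M$ with $\gamma(0)=x$, $\gamma(1)=y$'' is $\gamma(t)=\mathrm{Exp}_x(t\,\mathrm{Exp}_x^{-1}(y))$. $\Gamma_x^y:T_x\mathcal M\to T_y\mathcal M$ is parallel transport along this geodesic. $\mathcal X\subset\mathcal M$ is compact and geodesically convex (the geodesic between two points of $\mathcal X$ stays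 in $\mathcal X$). $\mathrm{grad}$ is the Riemannian gradient (in the first argument for $\phi(\cdot,\xi)$). A differentiable $f:\mathcal M\to\mathbb R$ is $L$-smooth if $\|\mathrm{grad}\,f(y)-\Gamma_x^y\,\mathrm{grad}\,f(x)\|\le L\,d(x,y)$ for all $x,y\in\mathcal M$; it is g-convex if $f(y)\ge f(x)+\langle\mathrm{grad}\,f(x),\mathrm{Exp}_x^{-1}(y)\rangle_x$ for all $x,y\in\mathcal M$. Stochastic gradients are unbiased: $\mathbb E_{\xi\sim\mathcal P}[\mathrm{grad}\,\phi(x,\xi)]=\mathrm{grad}\,\Phi(x)$. Algorithm SRFW: given $x_0\in\mathcal X$, a number of iterations $K$, minibatch sizes $b_k$ and step sizes $\eta_k$, for $k=0,\dots,K-1$: draw $\xi_1,\dots,\xi_{b_k}$ i.i.d. from $\mathcal P$ (fresh, independent of the past); let $$y_k\in\operatorname{argmin}_{y\in\mathcal X}\Big\langle \tfrac{1}{b_k}\sum_{i=1}^{b_k}\mathrm{grad}\,\phi(x_k,\xi_i),\ \mathrm{Exp}_{x_k}^{-1}(y)\Big\rangle_{x_k};$$ set $x_{k+1}=\gamma(\eta_k)$, where $\gamma$ is the geodesic with $\gamma(0)=x_k$, $\gamma(1)=y_k$. The output $\hat x$ is chosen uniformly at random from $\{x_0,\dots,x_{K-1}\}$. *)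

(* Defs.v *)
(* Riemannian manifolds, geodesics, parallel transport and the stochastic
   Riemannian Frank-Wolfe algorithm, over MathComp-Analysis. *)
From HB Require Import structures.
From mathcomp Require Export all_boot all_order all_algebra.
From mathcomp Require Export all_classical all_reals all_analysis.
Export Order.TTheory GRing.Theory Num.Theory.
Export numFieldNormedType.Exports.

Set Implicit Arguments.
#[export] Unset Strict Implicit.
#[export] Unset Printing Implicit Defensive.

Local Open Scope classical_set_scope.
Local Open Scope ring_scope.

Section Euclidean.
Context (R : realType) (n : nat).

Fixpoint diff_order (W : normedModType R) (k : nat) (f : 'rV[R]_n -> W)
    (D : set 'rV[R]_n) : Prop :=
  match k with
  | 0%N => forall u, D u -> {for u, continuous f}
  | k'.+1 => (forall u, D u -> differentiable f u) /\
             (forall v, diff_order k' (fun u => 'D_v f u) D)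
  end.

Definition smooth_on (W : normedModType R) (f : 'rV[R]_n -> W)
    (D : set 'rV[R]_n) : Prop := forall k, diff_order k f D.

Definition dot (G : 'M[R]_n) (v w : 'rV[R]_n) : R := (v *m G *m w^T) 0 0.

Definition partial (j : 'I_n) (f : 'rV[R]_n -> R) (u : 'rV[R]_n) : R :=
  'D_(delta_mx 0 j) f u.

End Euclidean.

(* The atlas is indexed by the points themselves: [chart p] is a preferred chart
   around [p].  Charts are total functions, meaningful on [dom p] only, and
   [chartV p] inverts [chart p] there.  [gram p u] is the Gram matrix of the
   metric in the coordinates [chart p], at the coordinate point [u].  The
   carrier is pointed, hence nonempty. *)
Record riemannian_manifold (R : realType) (n : nat) := RiemannianManifold {
  carrier :> ptopologicalType;
  dom : carrier -> set carrier;
  chart : carrier -> carrier -> 'rV[R]_n;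
  chartV : carrier -> 'rV[R]_n -> carrier;
  gram : carrier -> 'rV[R]_n -> 'M[R]_n;
  carrier_hausdorff : hausdorff_space carrier;
  carrier_countable : @second_countable carrier;
  dom_open : forall p, open (dom p);
  dom_self : forall p, dom p p;
  image_open : forall p, open (chart p @` dom p);
  chartK : forall p x, dom p x -> chartV p (chart p x) = x;
  chart_continuous : forall p x, dom p x -> {for x, continuous (chart p)};
  chartV_continuous : forall p x, dom p x ->
    {for chart p x, continuous (chartV p)};
  transition_smooth : forall p q,
    smooth_on (chart q \o chartV p) (chart p @` (dom p `&` dom q));
  gram_smooth : forall p i j,
    smooth_on (fun u => gram p u i j) (chart p @` dom p);
  gram_sym : forall p x, dom p x -> (gram p (chart p x))^T = gram p (chart p x);
  gram_pos : forall p x v, dom p x -> v != 0 ->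
    0 < dot (gram p (chart p x)) v v;
  gram_transition : forall p q x v w, dom p x -> dom q x ->
    dot (gram p (chart p x)) v w =
    dot (gram q (chart q x)) ('D_v (chart q \o chartV p) (chart p x))
                             ('D_w (chart q \o chartV p) (chart p x))
}.

Section Riemannian.
Context (R : realType) (n : nat) (M : riemannian_manifold R n).
Implicit Types (p x y : M) (v : 'rV[R]_n) (c : R -> M) (V : R -> 'rV[R]_n).

(* The tangent space T_x M is 'rV_n, a tangent vector being given by its
   components in the preferred chart at x.  Hence every vector below comes
   with a base point, and vectors at different points are not comparable. *)

Definition inner x v (w : 'rV[R]_n) : R := dot (gram x (chart x x)) v w.

Definition tnorm x v : R := Num.sqrt (inner x v v).

(* components in [chart p] of the vector with components v at x *)
Definition components p x v : 'rV[R]_n :=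
  'D_v (chart p \o chartV x) (chart x x).

Definition mdifferentiable (f : M -> R) x : Prop :=
  differentiable (f \o chartV x) (chart x x).

(* grad^i = sum_j (df)_j g^{ji}, so that <grad f(x), v>_x = df_x(v) *)
Definition grad (f : M -> R) x : 'rV[R]_n :=
  (\row_j partial j (f \o chartV x) (chart x x)) *m invmx (gram x (chart x x)).

Definition velocity c (t : R) : 'rV[R]_n := 'D_1 (chart (c t) \o c) t.

(* Christoffel symbol Gamma^k_{ij} of the Levi-Civita connection in [chart p] *)
Definition christoffel p (u : 'rV[R]_n) (k i j : 'I_n) : R :=
  2^-1 * \sum_l invmx (gram p u) k l *
    (partial i (fun z => gram p z j l) u + partial j (fun z => gram p z i l) u
     - partial l (fun z => gram p z i j) u).

Definition christoffel_map p (u v w : 'rV[R]_n) : 'rV[R]_n :=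
  \row_k \sum_i \sum_j christoffel p u k i j * v 0 i * w 0 j.

(* Curves parametrized by [0,1] are required to satisfy their conditions on
   an open interval containing it, so that derivatives are two-sided. *)
Definition near_unit (Q : R -> Prop) : Prop :=
  exists2 e : R, 0 < e & forall t, - e < t < 1 + e -> Q t.

Definition C1_at c (t : R) : Prop :=
  let u := chart (c t) \o c in
  [/\ {for t, continuous c}, \forall s \near t, derivable u s 1 &
      {for t, continuous (fun s => 'D_1 u s)}].

Definition geodesic_at c (t : R) : Prop :=
  let u := chart (c t) \o c in
  [/\ {for t, continuous c}, \forall s \near t, derivable u s 1,
      derivable (fun s => 'D_1 u s) t 1 &
      'D_1 (fun s => 'D_1 u s) t =
        - christoffel_map (c t) (u t) ('D_1 u t) ('D_1 u t)].

(* V s is a tangent vector at c s, with vanishing covariant derivative *)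
Definition parallel_at c V (t : R) : Prop :=
  let Vt := fun s => components (c t) (c s) (V s) in
  derivable Vt t 1 /\
  'D_1 Vt t =
    - christoffel_map (c t) (chart (c t) (c t)) (velocity c t) (V t).

Definition geodesic c : Prop := near_unit (geodesic_at c).

Definition parallel c V : Prop := near_unit (parallel_at c V).

Definition curve_length c : R :=
  \int[lebesgue_measure]_(t in `[0, 1]) tnorm (c t) (velocity c t).

(* [path_length x y l]: some piecewise C^1 curve from x to y has length l *)
Inductive path_length : M -> M -> R -> Prop :=
| path_nil x : path_length x x 0
| path_cons c y l : near_unit (C1_at c) -> path_length (c 1) y l ->
    path_length (c 0) y (curve_length c + l).

Definition dist x y : R := inf [set l | path_length x y l].

(* Exp_x(v) = c(1) for the geodesic c with c(0) = x and c'(0) = v.  No condition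
   at the pairs (x, v) for which there is no such geodesic on [0,1]. *)
Definition exponential_map (Exp : M -> 'rV[R]_n -> M) : Prop :=
  forall c, geodesic c -> Exp (c 0) (velocity c 0) = c 1.

Definition exp_defined x v : Prop :=
  exists c, [/\ geodesic c, c 0 = x & velocity c 0 = v].

(* Exp_x^{-1}(y) is the unique preimage of y of norm d(x, y) *)
Definition inverse_exponential (Exp : M -> 'rV[R]_n -> M)
    (Log : M -> M -> 'rV[R]_n) : Prop :=
  forall x y,
  [/\ exp_defined x (Log x y), Exp x (Log x y) = y,
      tnorm x (Log x y) = dist x y &
      forall v, exp_defined x v -> Exp x v = y -> tnorm x v = dist x y ->
        v = Log x y].

Section WithExp.
Context (Exp : M -> 'rV[R]_n -> M) (Log : M -> M -> 'rV[R]_n).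

Definition geo x y (t : R) : M := Exp x (t *: Log x y).

Definition parallel_transport (Tr : M -> M -> 'rV[R]_n -> 'rV[R]_n) : Prop :=
  forall x y v, exists V, [/\ parallel (geo x y) V, V 0 = v & V 1 = Tr x y v].

Definition geodesically_convex (X : set M) : Prop :=
  forall x y t, X x -> X y -> 0 <= t <= 1 -> X (geo x y t).

Definition L_smooth (Tr : M -> M -> 'rV[R]_n -> 'rV[R]_n) (L : R)
    (f : M -> R) : Prop :=
  (forall x, mdifferentiable f x) /\
  (forall x y, tnorm y (grad f y - Tr x y (grad f x)) <= L * dist x y).

Definition g_convex (f : M -> R) : Prop :=
  (forall x, mdifferentiable f x) /\
  (forall x y, f x + inner x (grad f x) (Log x y) <= f y).

End WithExp.

Definition argmin (X : set M) (f : M -> R) : set M :=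
  [set y | X y /\ forall z, X z -> f y <= f z].

Definition borel := g_sigma_algebraType (@open M).

Section Stochastic.
Context (dXi : measure_display) (Xi : measurableType dXi)
  (P : probability Xi R) (phi : M -> Xi -> R).

Definition objective x : R := \int[P]_z phi x z.

Definition stoch_grad x (z : Xi) : 'rV[R]_n := grad (phi^~ z) x.

Definition stochastic_objective : Prop :=
  [/\ measurable_fun setT (fun q : borel * Xi => phi q.1 q.2),
      forall x, P.-integrable setT (EFin \o phi x) &
      forall z x, mdifferentiable (phi^~ z) x].

(* E[grad phi(x, .)] = grad Phi(x) in T_x M, componentwise *)
Definition unbiased : Prop := forall x j,
  P.-integrable setT (fun z => (stoch_grad x z 0 j)%:E) /\
  \int[P]_z stoch_grad x z 0 j = grad objective x 0 j.

Context (Exp : M -> 'rV[R]_n -> M) (Log : M -> M -> 'rV[R]_n) (X : set M).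

Context (dO : measure_display) (Omega : measurableType dO)
  (Pr : probability Omega R).

(* A run: xi k i is the i-th sample of iteration k (i < b k), x k and y k are
   the iterates. *)
Context (xi : nat -> nat -> Omega -> Xi) (x y : nat -> Omega -> M).

(* events determined by x_0, ..., x_k, y_0, ..., y_{k-1} and the samples of the
   iterations 0, ..., k-1 *)
Definition history (b : nat -> nat) (k : nat) : set (set Omega) :=
  <<s [set A | [\/ exists j U, [/\ (j <= k)%N, open U & A = x j @^-1` U],
                   exists j U, [/\ (j < k)%N, open U & A = y j @^-1` U] |
                   exists j i B, [/\ (j < k)%N, (i < b j)%N, measurable B &
                                     A = xi j i @^-1` B]]] >>.

Definition minibatch_grad (b : nat -> nat) (k : nat) (w : Omega) : 'rV[R]_n :=
  (b k)%:R^-1 *: \sum_(i < b k) stoch_grad (x k w) (xi k i w).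

Record SRFW (x0 : M) (K : nat) (b : nat -> nat) (eta : nat -> R) : Prop := {
  srfw_sample_measurable : forall k i, (k < K)%N -> (i < b k)%N ->
    measurable_fun setT (xi k i);
  srfw_x_measurable : forall k, (k <= K)%N ->
    measurable_fun setT (x k : Omega -> borel);
  srfw_y_measurable : forall k, (k < K)%N ->
    measurable_fun setT (y k : Omega -> borel);
  (* taking A = setT, the samples of iteration k are i.i.d. with law P *)
  srfw_sample_fresh : forall k A (B : nat -> set Xi), (k < K)%N ->
    history b k A -> (forall i, measurable (B i)) ->
    fine (Pr (A `&` \bigcap_(i < b k) (xi k i @^-1` B i))) =
    fine (Pr A) * \prod_(i < b k) fine (P (B i));
  srfw_init : forall w, x 0%N w = x0;
  srfw_argmin : forall k w, (k < K)%N ->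
    argmin X (fun z => inner (x k w) (minibatch_grad b k w) (Log (x k w) z))
      (y k w);
  srfw_step : forall k w, (k < K)%N ->
    x k.+1 w = geo Exp Log (x k w) (y k w) (eta k)
}.

(* xhat = x_kappa with kappa uniform on {0, ..., K-1} and independent of the
   run *)
Definition uniform_output (K : nat) (b : nat -> nat) (xhat : Omega -> M) :
    Prop :=
  exists kappa : Omega -> 'I_K,
  [/\ forall j, measurable (kappa @^-1` [set j]),
      forall j A, history b K A ->
        fine (Pr (kappa @^-1` [set j] `&` A)) = K%:R^-1 * fine (Pr A) &
      forall w, xhat w = x (kappa w) w].

End Stochastic.
End Riemannian.

(* Main.v *)
Require Import Defs.
From mathcomp Require Import ring lra measurable_realfun.

Set Implicit Arguments.

Local Open Scope classical_set_scope.
Local Open Scope ring_scope.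

(** Write eta for the step size, D for the diameter of X, and delta_k for the
    norm of the difference between the minibatch gradient and the gradient of
    Phi at x_k.  One iteration satisfies [frank_wolfe_step]:

      eta * (Phi x_k - Phi xstar) <= Phi x_k - Phi x_(k+1)
                                     + eta * 2 * D * delta_k + |L| * (eta * D)^2.

    Since 2 * eta * delta_k <= eta^2 + delta_k^2 and eta^2 = 1 / K, the sum over
    the K iterations telescopes to a constant plus D times the sum of the
    delta_k^2.  The samples of a minibatch are independent of each other and of
    x_k, so their gradient errors are uncorrelated and delta_k^2 has mean at most
    (2 * C)^2 / K ([minibatch_variance]).  Hence the sum of the expected gaps is
    at most A / eta = A * sqrt K for a constant A.  The expected gap of the
    output is the average of the expected gaps of the iterates
    ([uniform_output_mean]), that is, at most A / sqrt K.

    The inequality for one step rests on [descent].  By g-convexity at the new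
    point z, Phi z <= Phi x - <grad Phi z, Log z x>.  L-smoothness replaces
    grad Phi z by the transport of grad Phi x, at a cost of |L| * d(x, z)^2, and
    transport is an isometry that carries Log x z to - Log z x
    ([transport_Log]).  No derivative of Phi along the geodesic is taken.  The
    isometry holds because the Christoffel symbols define a metric connection
    ([christoffel_metric], [parallel_inner]); in particular geodesics have
    constant speed, so their lengths are the norms of their initial velocities,
    and the uniqueness of the logarithm identifies the logarithms between points
    of one geodesic ([Log_geo], [velocity_geo1]).  The diameter D is finite
    because each point is at bounded distance from its neighbours
    ([dist_locally_bounded]) and X is compact.

    The expectation of delta_k^2 requires the pairing of two stochastic gradients
    to be jointly measurable in the point and the samples, although the
    components of a gradient at x refer to a chart that varies arbitrarily with
    x.  The pairing itself does not depend on the chart ([inner_grad]): near a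
    fixed point it is an expression in the inverse Gram matrix and in partial
    derivatives, which are limits of difference quotients
    ([measurable_inner_grad]).  Fubini's theorem for the joint law of
    ((x_k, xi_i), xi_j) then makes the cross terms vanish
    ([run_correlation_cross]). *)

(** * Calculus *)

Lemma derive_comp (R : realType) (V W : normedModType R) (f : R -> V)
    (g : V -> W) (t : R) :
  derivable f t 1 -> differentiable g (f t) ->
  is_derive t 1 (g \o f) ('D_('D_1 f t) g (f t)).
Proof.
move=> /derivable1_diffP df dg.
have dgf := differentiable_comp df dg.
apply: DeriveDef; first exact/derivable1_diffP.
by rewrite !deriveE // diff_comp.
Qed.

Section NearEq.
Context (R : realType) (W : normedModType R) (f g : R -> W) (t : R).
Hypothesis fg : \forall s \near t, f s = g s.

Lemma continuous_near_eq : {for t, continuous f} -> {for t, continuous g}.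
Proof.
rewrite /prop_for /continuous_at -(nbhs_singleton fg); apply: cvg_trans.
exact: near_eq_cvg.
Qed.

Lemma derivable_near_eq : derivable f t 1 -> derivable g t 1.
Proof. exact: near_eq_derivable. Qed.

Lemma derive_near_eq : 'D_1 f t = 'D_1 g t.
Proof. exact: near_eq_derive. Qed.

End NearEq.

Lemma is_derive_scale (R : realType) (W : normedModType R) (f : R -> W)
    (b t : R) : derivable f t 1 ->
  is_derive t 1 (fun s => b *: f s) (b *: 'D_1 f t).
Proof. by move=> /derivableP df; exact: is_deriveZ. Qed.

Lemma zero_derivative_constant (R : realType) (f : R -> R) :
  near_unit (fun t => is_derive t 1 f 0) ->
  forall t, 0 <= t <= 1 -> f t = f 0.
Proof.
move=> [e e0 df] t /andP[t0 t1].
have df01 s : s \in `[0, t] -> is_derive s 1 f 0.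
  rewrite in_itv /= => /andP[s0 st]; apply: df.
  rewrite (lt_le_trans _ s0) ?oppr_lt0 //= (le_lt_trans st) //.
  by rewrite (le_lt_trans t1) // ltrDl.
have dfoo s : s \in `]0, t[ -> is_derive s 1 f 0.
  by move=> /subset_itv_oo_cc; exact: df01.
have fc : {within `[0, t], continuous f}.
  by apply: derivable_within_continuous => s /df01 [].
have [c _] := MVT_segment t0 dfoo fc.
by rewrite mul0r => /eqP; rewrite subr_eq0 => /eqP.
Qed.

Section Dot.
Context (R : realType) (n : nat).
Implicit Types (G : 'M[R]_n) (v w z : 'rV[R]_n).

Lemma dotE G v w : dot G v w = \sum_i \sum_j v 0 i * G i j * w 0 j.
Proof.
rewrite /dot mxE exchange_big /=; apply: eq_bigr => j _.
by rewrite !mxE mulr_suml.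
Qed.

Lemma dotDl G v w z : dot G (v + w) z = dot G v z + dot G w z.
Proof. by rewrite /dot !mulmxDl mxE. Qed.

Lemma dotZl G a v z : dot G (a *: v) z = a * dot G v z.
Proof. by rewrite /dot -!scalemxAl mxE. Qed.

Lemma dotDr G v w z : dot G z (v + w) = dot G z v + dot G z w.
Proof. by rewrite /dot linearD mulmxDr mxE. Qed.

Lemma dotZr G a v z : dot G z (a *: v) = a * dot G z v.
Proof. by rewrite /dot linearZ /= -scalemxAr mxE. Qed.

Lemma dotC G v w : G^T = G -> dot G v w = dot G w v.
Proof.
move=> GT.
have E : v *m G *m w^T = (w *m G *m v^T)^T by rewrite !trmx_mul trmxK GT mulmxA.
by rewrite /dot E [LHS]mxE.
Qed.

Lemma posdef_unitmx G : (forall v, v != 0 -> 0 < dot G v v) -> G \in unitmx.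
Proof.
move=> pG; rewrite -row_free_unit -kermx_eq0; apply/rowV0P => v.
move=> /sub_kermxP vG0; apply/eqP; apply: contraT => /pG.
by rewrite /dot vG0 mul0mx mxE ltxx.
Qed.

End Dot.

Lemma is_derive_coord (R : realType) m n (a : R -> 'M[R]_(m, n)) t i j :
  derivable a t 1 -> is_derive t 1 (fun s => a s i j) ('D_1 a t i j).
Proof.
move=> da; apply: DeriveDef; first by move/derivable_mxP: da.
by rewrite derive_mx // mxE.
Qed.

Lemma is_derive_dot (R : realType) n (G : R -> 'M[R]_n) (a b : R -> 'rV[R]_n) t :
  derivable G t 1 -> derivable a t 1 -> derivable b t 1 ->
  is_derive t 1 (fun s => dot (G s) (a s) (b s))
    (dot (G t) ('D_1 a t) (b t) + dot ('D_1 G t) (a t) (b t)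
     + dot (G t) (a t) ('D_1 b t)).
Proof.
move=> dG da db.
have -> : (fun s => dot (G s) (a s) (b s)) =
    \sum_i \sum_j ((fun s => a s 0 i) * (fun s => G s i j) * (fun s => b s 0 j)).
  apply/funext => s; rewrite dotE fct_sumE; apply: eq_bigr => i _.
  by rewrite fct_sumE.
have da' i := is_derive_coord 0 i da.
have db' i := is_derive_coord 0 i db.
have dG' i j := is_derive_coord i j dG.
apply: is_derive_eq.
rewrite !dotE -!big_split /=; apply: eq_bigr => i _.
rewrite -!big_split /=; apply: eq_bigr => j _.
by rewrite !fctE /GRing.scale /=; ring.
Qed.

(** * Changes of chart and the metric along curves *)

Section Charts.
Context (R : realType) (n : nat) (M : riemannian_manifold R n).
Implicit Types (p q x : M) (c : R -> M) (V W : R -> 'rV[R]_n) (t : R).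

Lemma dom_nbhs p x : dom p x -> nbhs x (dom p).
Proof. by move=> px; apply: open_nbhs_nbhs; split => //; exact: dom_open. Qed.

Lemma image_nbhs p x : dom p x -> nbhs (chart p x) (chart p @` dom p).
Proof.
move=> px; apply: open_nbhs_nbhs; split; first exact: image_open.
by exists x.
Qed.

Lemma transition_differentiable p q x : dom p x -> dom q x ->
  differentiable (chart q \o chartV p) (chart p x).
Proof.
by move=> px qx; have [+ _] := transition_smooth p q 1%N; apply; exists x.
Qed.

Lemma gram_differentiable p i j x : dom p x ->
  differentiable (fun u => gram p u i j) (chart p x).
Proof.
by move=> px; have [+ _] := gram_smooth p i j 1%N; apply; exists x.
Qed.

Lemma gram_unit p x : dom p x -> gram p (chart p x) \in unitmx.
Proof. by move=> px; apply: posdef_unitmx => v; exact: gram_pos. Qed.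

Lemma near_dom c p t : {for t, continuous c} -> dom p (c t) ->
  \forall s \near t, dom p (c s).
Proof. by move=> ct /dom_nbhs; exact: ct. Qed.

(** The coordinates of a curve in one chart are those in another chart composed
    with the transition map, so the chain rule gives the velocity. *)
Lemma change_chart_curve c p q t : {for t, continuous c} ->
  dom p (c t) -> dom q (c t) -> derivable (chart p \o c) t 1 ->
  is_derive t 1 (chart q \o c)
    ('D_('D_1 (chart p \o c) t) (chart q \o chartV p) (chart p (c t))).
Proof.
move=> ct pt qt dp.
apply: (@near_eq_is_derive _ _ _ ((chart q \o chartV p) \o (chart p \o c))).
  by near=> s; rewrite /= chartK//; near: s; exact: near_dom.
exact/derive_comp/transition_differentiable.
Unshelve. all: by end_near. Qed.

Lemma components_velocity c p t : {for t, continuous c} -> dom p (c t) ->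
  derivable (chart (c t) \o c) t 1 ->
  components p (c t) (velocity c t) = 'D_1 (chart p \o c) t.
Proof.
move=> ct pt dt; rewrite /components /velocity.
by have [_ ->] := change_chart_curve ct (dom_self (c t)) pt dt.
Qed.

Lemma components_self x v : components x x v = v.
Proof.
rewrite /components (near_eq_derive (g := id)) ?derive_id//.
near=> u; have [y xy <-] : (chart x @` dom x) u.
  by near: u; apply: image_nbhs; exact: dom_self.
by rewrite /= chartK.
Unshelve. all: by end_near. Qed.

Lemma inner_components p x v w : dom p x ->
  inner x v w = dot (gram p (chart p x)) (components p x v) (components p x w).
Proof. by move=> px; rewrite /inner (gram_transition v w (dom_self x) px). Qed.

Lemma innerC x v w : inner x v w = inner x w v.
Proof. by apply: dotC; apply: gram_sym; exact: dom_self. Qed.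

Lemma innerDl x v w z : inner x (v + w) z = inner x v z + inner x w z.
Proof. exact: dotDl. Qed.

Lemma innerDr x v w z : inner x z (v + w) = inner x z v + inner x z w.
Proof. exact: dotDr. Qed.

Lemma innerZl x a v z : inner x (a *: v) z = a * inner x v z.
Proof. exact: dotZl. Qed.

Lemma innerZr x a v z : inner x z (a *: v) = a * inner x z v.
Proof. exact: dotZr. Qed.

Lemma innerNl x v z : inner x (- v) z = - inner x v z.
Proof. by rewrite -[- v]scaleN1r innerZl mulN1r. Qed.

Lemma innerNr x v z : inner x z (- v) = - inner x z v.
Proof. by rewrite innerC innerNl innerC. Qed.

Lemma inner0l x v : inner x 0 v = 0.
Proof. by rewrite /inner /dot !mul0mx mxE. Qed.

Lemma inner_ge0 x v : 0 <= inner x v v.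
Proof.
have [->|v0] := eqVneq v 0; first by rewrite inner0l.
by apply: ltW; apply: gram_pos => //; exact: dom_self.
Qed.

Lemma tnorm_ge0 x v : 0 <= tnorm x v. Proof. exact: sqrtr_ge0. Qed.

Lemma sqr_tnorm x v : tnorm x v ^+ 2 = inner x v v.
Proof. by rewrite sqr_sqrtr // inner_ge0. Qed.

Lemma tnormN x v : tnorm x (- v) = tnorm x v.
Proof. by rewrite /tnorm innerNl innerNr opprK. Qed.

Lemma tnormZ x a v : tnorm x (a *: v) = `|a| * tnorm x v.
Proof.
rewrite /tnorm innerZl innerZr mulrA -expr2 sqrtrM ?sqr_ge0//.
by rewrite sqrtr_sqr.
Qed.

Lemma cauchy_schwarz x v w : inner x v w <= tnorm x v * tnorm x w.
Proof.
have vw : 0 <= tnorm x v * tnorm x w by rewrite mulr_ge0 ?tnorm_ge0.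
have [/eqP w0|w0] := boolP (tnorm x w == 0).
  have w00 : w = 0.
    apply/eqP; apply: contraT => /(gram_pos (dom_self x)).
    by rewrite -/(inner x w w) -sqr_tnorm w0 expr0n /= ltxx.
  by rewrite {1}w00 innerC inner0l.
have w2 : 0 < tnorm x w by rewrite lt_neqAle eq_sym w0 tnorm_ge0.
have := inner_ge0 x (tnorm x w *: v - (inner x v w / tnorm x w) *: w).
rewrite !(innerDl, innerDr, innerNl, innerNr, innerZl, innerZr).
rewrite (innerC x w v) -!sqr_tnorm.
set a := tnorm x v in vw *; set b := tnorm x w in w0 w2 vw *.
set i := inner x v w => H.
have E : 0 <= a ^+ 2 * b ^+ 2 - i ^+ 2.
  apply: le_trans H _; rewrite le_eqVlt; apply/orP; left; apply/eqP.
  by field.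
rewrite leNgt; apply/negP => lt_i.
have : (a * b) ^+ 2 < i ^+ 2 by rewrite ltr_pXn2r // nnegrE ltW // (le_lt_trans vw).
by rewrite exprMn; lra.
Qed.

Lemma tnormD x v w : tnorm x (v + w) <= tnorm x v + tnorm x w.
Proof.
have H : 0 <= tnorm x v + tnorm x w by rewrite addr_ge0 ?tnorm_ge0.
rewrite -(@ler_pXn2r _ 2) ?nnegrE ?tnorm_ge0//.
rewrite sqr_tnorm !(innerDl, innerDr) (innerC x w v) -!sqr_tnorm.
by have := cauchy_schwarz x v w; nra.
Qed.

Lemma curve_gram_derivable c t p : derivable (chart p \o c) t 1 ->
  dom p (c t) -> is_derive t 1 (fun s => gram p (chart p (c s)))
   (\matrix_(i, j) \sum_k 'D_1 (chart p \o c) t 0 k *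
       partial k (fun u => gram p u i j) (chart p (c t))).
Proof.
move=> dc pt.
have dg i j := derive_comp dc (gram_differentiable i j pt).
have dG : derivable (fun s => gram p (chart p (c s))) t 1.
  by apply/derivable_mxP => i j; have [] := dg i j.
apply: DeriveDef => //; rewrite derive_mx //; apply/matrixP => i j.
rewrite !mxE; have [_ ->] := dg i j.
set v := 'D_1 _ t; rewrite deriveE; last exact: gram_differentiable.
rewrite [X in 'd _ _ X]row_sum_delta linear_sum /=; apply: eq_bigr => k _.
by rewrite linearZ /= /partial deriveE //; exact: gram_differentiable.
Qed.

Lemma partial_gram_sym p x i j k : dom p x ->
  partial k (fun u => gram p u i j) (chart p x) =
  partial k (fun u => gram p u j i) (chart p x).
Proof.
move=> px; apply: near_eq_derive; near=> u.
have [y py <-] : (chart p @` dom p) u by near: u; exact: image_nbhs.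
by rewrite -[in LHS](gram_sym py) mxE.
Unshelve. all: by end_near. Qed.

(** Multiplying by the Gram matrix cancels its inverse in the Christoffel symbol. *)
Lemma christoffel_lower p x i j l : dom p x ->
  \sum_k christoffel p (chart p x) k i j * gram p (chart p x) k l =
  2^-1 * (partial i (fun z => gram p z j l) (chart p x)
          + partial j (fun z => gram p z i l) (chart p x)
          - partial l (fun z => gram p z i j) (chart p x)).
Proof.
move=> px; set T := fun m => partial i (fun z => gram p z j m) (chart p x)
          + partial j (fun z => gram p z i m) (chart p x)
          - partial m (fun z => gram p z i j) (chart p x).
rewrite -[X in _ = _ * X]/(T l).
transitivity (2^-1 * \sum_m T m * \sum_k gram p (chart p x) l k *
                 invmx (gram p (chart p x)) k m).
  rewrite mulr_sumr (eq_bigr (fun k => \sum_m 2^-1 * (T m *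
     (gram p (chart p x) l k * invmx (gram p (chart p x)) k m)))).
    rewrite exchange_big /=; apply: eq_bigr => m _.
    by rewrite -mulr_sumr -mulr_sumr.
  move=> k _; rewrite /christoffel -mulrA mulr_suml mulr_sumr.
  have kl : gram p (chart p x) k l = gram p (chart p x) l k.
    by rewrite -[in LHS](gram_sym px) mxE.
  by apply: eq_bigr => m _; rewrite kl -/(T m); ring.
have GV m : \sum_k gram p (chart p x) l k * invmx (gram p (chart p x)) k m =
            (l == m)%:R.
  by have := mulmxV (gram_unit px); move/matrixP/(_ l m); rewrite !mxE => ->.
congr (_ * _); rewrite (bigD1 l) //= GV eqxx mulr1 big1 ?addr0// => m ml.
by rewrite GV eq_sym (negPf ml) mulr0.
Qed.

Lemma dot_christoffel p x v w z : dom p x ->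
  dot (gram p (chart p x)) (christoffel_map p (chart p x) v w) z =
  \sum_i \sum_j \sum_l v 0 i * w 0 j * z 0 l *
    (2^-1 * (partial i (fun u => gram p u j l) (chart p x)
          + partial j (fun u => gram p u i l) (chart p x)
          - partial l (fun u => gram p u i j) (chart p x))).
Proof.
move=> px; rewrite dotE exchange_big /=.
rewrite [RHS](eq_bigr (fun i => \sum_l \sum_j v 0 i * w 0 j * z 0 l *
    (2^-1 * (partial i (fun u => gram p u j l) (chart p x)
          + partial j (fun u => gram p u i l) (chart p x)
          - partial l (fun u => gram p u i j) (chart p x))))); last first.
  by move=> i _; rewrite exchange_big.
rewrite [RHS]exchange_big /=; apply: eq_bigr => l _.
rewrite (eq_bigr (fun k => \sum_i \sum_j v 0 i * w 0 j * z 0 l *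
   (christoffel p (chart p x) k i j * gram p (chart p x) k l))).
  rewrite exchange_big /=; apply: eq_bigr => i _.
  rewrite exchange_big /=; apply: eq_bigr => j _.
  by rewrite -christoffel_lower // mulr_sumr.
move=> k _; rewrite mxE !mulr_suml; apply: eq_bigr => i _.
by rewrite !mulr_suml; apply: eq_bigr => j _; ring.
Qed.

(** The Christoffel symbols are those of a metric connection: lowering an index
    leaves half the sum of three partial derivatives of the metric, and the
    antisymmetric ones cancel when the two slots are exchanged. *)
Lemma christoffel_metric p x v a b : dom p x ->
  dot (gram p (chart p x)) (christoffel_map p (chart p x) v a) b
  + dot (gram p (chart p x)) a (christoffel_map p (chart p x) v b) =
  dot (\matrix_(i, j) \sum_k v 0 k * partial k (fun u => gram p u i j) (chart p x)) a b.
Proof.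
move=> px; rewrite [X in _ + X]dotC ?gram_sym// !dot_christoffel//.
rewrite -big_split /= dotE.
rewrite [RHS](eq_bigr (fun j => \sum_i \sum_l v 0 i * a 0 j * b 0 l *
   partial i (fun u => gram p u j l) (chart p x))); last first.
  move=> j _; rewrite exchange_big /=; apply: eq_bigr => l _.
  rewrite mxE mulr_sumr mulr_suml; apply: eq_bigr => i _; ring.
rewrite [RHS]exchange_big /=; apply: eq_bigr => i _.
rewrite [X in _ + X]exchange_big -big_split /=; apply: eq_bigr => j _.
rewrite -big_split /=; apply: eq_bigr => l _.
rewrite (partial_gram_sym l j i px) (partial_gram_sym j l i px).
by field.
Qed.

End Charts.

(** * Geodesics and the exponential map *)

Section NearUnit.
Context (R : realType).
Implicit Types Q : R -> Prop.

Lemma near_unitS Q1 Q2 : (forall t, Q1 t -> Q2 t) -> near_unit Q1 ->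
  near_unit Q2.
Proof. by move=> Q12 [e e0 h]; exists e => // t /h/Q12. Qed.

Lemma near_unitI Q1 Q2 : near_unit Q1 -> near_unit Q2 ->
  near_unit (fun t => Q1 t /\ Q2 t).
Proof.
move=> [e1 e10 h1] [e2 e20 h2]; exists (Num.min e1 e2).
  by rewrite lt_min e10.
move=> t; rewrite -ltrBlDl lt_min ltrNl lt_min => /andP[] /andP[? ?] /andP[? ?].
by split; [apply: h1|apply: h2]; apply/andP; split; lra.
Qed.

Lemma near_unit_open Q : near_unit Q ->
  near_unit (fun t => Q t /\ \forall s \near t, Q s).
Proof.
move=> [e e0 h]; exists e => // t et; split; first exact: h.
have : t \in `]- e, 1 + e[ by rewrite in_itv.
by move=> /near_in_itvoo; apply: filterS => s; rewrite in_itv => /h.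
Qed.

(** Conditions on the closed unit interval are stated on a slightly larger one;
    this margin survives an affine change of parameter that maps 0 and 1 into
    the open interval where the condition is known. *)
Lemma near_unit_affine Q (l r a b : R) : (forall t, l < t < r -> Q t) ->
  l < a < r -> l < a + b < r -> near_unit (fun t => Q (a + b * t)).
Proof.
move=> h /andP[la ar] /andP[lab abr].
(* the margin left by the images a of 0 and a + b of 1 *)
pose d := Num.min (Num.min (a - l) (r - a)) (Num.min (a + b - l) (r - (a + b))).
have d0 : 0 < d by rewrite !lt_min !subr_gt0 la ar lab abr.
have [d1 d2 d3 d4] : [/\ d <= a - l, d <= r - a, d <= a + b - l & d <= r - (a + b)].
  by split; rewrite !ge_min lexx ?orbT.
have b1 : 0 < `|b| + 1 by rewrite ltr_pwDr.
exists (d / (`|b| + 1)); first by rewrite divr_gt0.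
set e := d / _ => t /andP[t0 t1]; apply: h.
have e0 : 0 < e by rewrite divr_gt0.
have be : `|b| * e < d by rewrite -[ltRHS](divfK (lt0r_neq0 b1)) -/e; nra.
have [b0|b0] := leP 0 b.
  by rewrite ger0_norm // in be; apply/andP; split; nra.
by rewrite ltr0_norm // in be; apply/andP; split; nra.
Qed.

End NearUnit.

Section Geodesics.
Context (R : realType) (n : nat) (M : riemannian_manifold R n).
Implicit Types (p q x y : M) (c : R -> M) (V W : R -> 'rV[R]_n) (t : R).

Definition differentiable_curve c := near_unit (fun t =>
  {for t, continuous c} /\ derivable (chart (c t) \o c) t 1).

Lemma geodesic_differentiable c : geodesic c -> differentiable_curve c.
Proof.
by apply: near_unitS => t [ct /nbhs_singleton].
Qed.

Lemma christoffel_mapZ p u (a b : R) v w :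
  christoffel_map p u (a *: v) (b *: w) = (a * b) *: christoffel_map p u v w :> 'rV[R]_n.
Proof.
apply/rowP => k; rewrite !mxE mulr_sumr; apply: eq_bigr => i _.
rewrite mulr_sumr; apply: eq_bigr => j _; rewrite !mxE; ring.
Qed.

(** Parallel transport along a curve is an isometry, the connection being
    metric. *)
Lemma parallel_inner c V W : differentiable_curve c ->
  parallel c V -> parallel c W ->
  forall t, 0 <= t <= 1 -> inner (c t) (V t) (W t) = inner (c 0) (V 0) (W 0).
Proof.
move=> dc pV pW; apply: (@zero_derivative_constant _ (fun t => inner (c t) (V t) (W t))).
apply: near_unitS (near_unitI dc (near_unitI pV pW)) => t [[ct ut] [[Vt EV] [Wt EW]]].
set Vt' := (fun s => components (c t) (c s) (V s)) in Vt EV.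
set Wt' := (fun s => components (c t) (c s) (W s)) in Wt EW.
have dct := dom_self (c t).
have [dG EG] := curve_gram_derivable ut dct.
apply: (@near_eq_is_derive _ _ _
  (fun s => dot (gram (c t) (chart (c t) (c s))) (Vt' s) (Wt' s))).
  near=> s; rewrite (@inner_components _ _ _ (c t))//; near: s; exact: near_dom.
apply: is_derive_eq (is_derive_dot dG Vt Wt) _.
rewrite EG EV EW /Vt' /Wt' !components_self.
rewrite -(christoffel_metric _ _ _ dct) -/(velocity c t).
have dN (G : 'M[R]_n) a b : dot G (- a) b = - dot G a b.
  by rewrite /dot !mulNmx mxE.
have dNr (G : 'M[R]_n) a b : dot G a (- b) = - dot G a b.
  by rewrite /dot linearN /= mulmxN mxE.
by rewrite dN dNr; ring.
Unshelve. all: by end_near. Qed.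

(** In a fixed chart the velocity has the coordinates of the derivative, so the
    geodesic equation is the equation of parallel transport. *)
Lemma velocity_parallel c : geodesic c -> parallel c (velocity c).
Proof.
move=> gc; apply: near_unitS (near_unit_open gc) => t [[ct ut dut E] gt].
have eqV : \forall s \near t, 'D_1 (chart (c t) \o c) s =
    components (c t) (c s) (velocity c s).
  near=> s.
  have [cs /nbhs_singleton us _ _] : geodesic_at c s by near: s; exact: gt.
  have ds : dom (c t) (c s).
    by near: s; apply: near_dom => //; exact: dom_self.
  by rewrite components_velocity.
split; first by apply: near_eq_derivable dut.
by rewrite -(near_eq_derive _ eqV).
Unshelve. all: by end_near. Qed.

Lemma affine_continuous (a b t : R) : {for t, continuous (fun s => a + b * s)}.
Proof. by apply: cvgD; [exact: cvg_cst|exact: mulrl_continuous]. Qed.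

Lemma near_affine (P : R -> Prop) (a b t : R) :
  (\forall s \near (a + b * t), P s) -> \forall s \near t, P (a + b * s).
Proof. exact: affine_continuous. Qed.

Lemma is_derive_affine (V : normedModType R) (f : R -> V) (a b t : R) :
  derivable f (a + b * t) 1 ->
  is_derive t 1 (fun s => f (a + b * s)) (b *: 'D_1 f (a + b * t)).
Proof.
move=> df; have da : is_derive t 1 (fun s => a + b * s) b.
  by apply: is_derive_eq; rewrite /GRing.scale /=; ring.
have [da1 da2] := da; move/derivable1_diffP: (df) => df'.
apply: is_derive_eq (derive_comp da1 df') _.
rewrite da2 (deriveE _ df') (deriveE _ df').
transitivity ('d f (a + b * t) (b *: (1 : R))); last exact: linearZ.
by rewrite [_ *: _]mulr1.
Qed.

(** The chart coordinates u are a parameter, since those of a reparametrized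
    curve arise as a reparametrization of u. *)
Lemma geodesic_in_chart c t u : u = chart (c t) \o c ->
  {for t, continuous c} -> (\forall s \near t, derivable u s 1) ->
  derivable (fun s => 'D_1 u s) t 1 ->
  'D_1 (fun s => 'D_1 u s) t =
    - christoffel_map (c t) (u t) ('D_1 u t) ('D_1 u t) -> geodesic_at c t.
Proof. by move=> ->. Qed.

(** The second derivative and the Christoffel term are both multiplied by the
    square of the slope. *)
Lemma geodesic_at_affine c (a b t : R) : geodesic_at c (a + b * t) ->
  geodesic_at (fun s => c (a + b * s)) t.
Proof.
move=> [cc dc ddc E]; set u := chart (c (a + b * t)) \o c in dc ddc E *.
have ac := @affine_continuous a b t.
have dcs : \forall s \near t, derivable u (a + b * s) 1.
  exact: (near_affine (P := fun s => derivable u s 1)).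
have eqD : \forall s \near t,
  b *: 'D_1 u (a + b * s) = 'D_1 (fun s => u (a + b * s)) s.
  near=> s; have ds : derivable u (a + b * s) 1 by near: s; exact: dcs.
  by have [_ ->] := is_derive_affine ds.
have [d1 d2] := is_derive_affine ddc.
apply: (@geodesic_in_chart _ _ (fun s => u (a + b * s))).
- exact: erefl.
- exact: (continuous_comp ac cc).
- near=> s; have ds : derivable u (a + b * s) 1 by near: s; exact: dcs.
  by have [] := is_derive_affine ds.
- by apply: (derivable_near_eq eqD); have [] := is_derive_scale b d1.
have [_ E3] := is_derive_scale b d1.
apply: (etrans (esym (derive_near_eq eqD))); apply: (etrans E3).
pose v := 'D_1 u (a + b * t).
transitivity (- christoffel_map (c (a + b * t)) (u (a + b * t)) (b *: v) (b *: v)).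
  by rewrite d2 E christoffel_mapZ scalerA scalerN.
by have /= <- := nbhs_singleton eqD.
Unshelve. all: by end_near. Qed.

Lemma velocity_affine c (a b t : R) :
  derivable (chart (c (a + b * t)) \o c) (a + b * t) 1 ->
  velocity (fun s => c (a + b * s)) t = b *: velocity c (a + b * t).
Proof. by move=> dc; rewrite /velocity; have [_ <-] := is_derive_affine dc. Qed.

End Geodesics.

(** * Distance and logarithms *)

Section Distance.
Context (R : realType) (n : nat) (M : riemannian_manifold R n).
Implicit Types (p q x y z : M) (c : R -> M) (t : R).

Lemma geodesic_at_near_eq c1 c2 t : (\forall s \near t, c1 s = c2 s) ->
  geodesic_at c1 t -> geodesic_at c2 t.
Proof.
move=> c12 [cc dc ddc E]; have ct := nbhs_singleton c12.
set u := chart (c1 t) \o c1 in dc ddc E.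
have cuv : \forall s \near t, u s = (chart (c2 t) \o c2) s.
  by near=> s; rewrite /u /= ct; congr chart; near: s.
have eqD : \forall s \near t, 'D_1 u s = 'D_1 (chart (c2 t) \o c2) s.
  near=> s; apply: near_eq_derive; near: s.
  exact: (nbhs_interior cuv).
split.
- by rewrite /prop_for /continuous_at -ct; apply: cvg_trans cc; exact: near_eq_cvg.
- near=> s; apply: (@near_eq_derivable _ _ _ u); last by near: s.
  by near: s; exact: (nbhs_interior cuv).
- exact: (near_eq_derivable eqD).
by rewrite -(near_eq_derive _ eqD) E -(nbhs_singleton cuv) -(nbhs_singleton eqD) ct.
Unshelve. all: by end_near. Qed.

Lemma geodesic_velocity_affine c (a b : R) : geodesic_at c a ->
  velocity (fun s => c (a + b * s)) 0 = b *: velocity c a.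
Proof.
move=> [_ /nbhs_singleton dc _ _].
have := @velocity_affine _ _ _ c a b 0; rewrite mulr0 addr0; exact.
Qed.

Lemma geodesic_affine c (l r a b : R) :
  (forall t, l < t < r -> geodesic_at c t) -> l < a < r -> l < a + b < r ->
  geodesic (fun t => c (a + b * t)).
Proof.
move=> gc la lab; apply: near_unitS (near_unit_affine gc la lab) => t.
exact: geodesic_at_affine.
Qed.

Lemma geodesic_C1 c : geodesic c -> near_unit (C1_at c).
Proof.
apply: near_unitS => t [ct dc ddc _]; split; [exact: ct|exact: dc|].
exact/differentiable_continuous/derivable1_diffP.
Qed.

(** The velocity is parallel, and parallel fields have constant inner products. *)
Lemma geodesic_speed c : geodesic c ->
  forall t, 0 <= t <= 1 -> tnorm (c t) (velocity c t) = tnorm (c 0) (velocity c 0).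
Proof.
move=> gc t t01; have pv := velocity_parallel gc.
by rewrite /tnorm (parallel_inner (geodesic_differentiable gc) pv pv).
Qed.

Lemma geodesic_length c : geodesic c ->
  curve_length c = tnorm (c 0) (velocity c 0).
Proof.
move=> gc; rewrite /curve_length.
rewrite (@eq_Rintegral _ _ _ _ _ (fun=> tnorm (c 0) (velocity c 0))); last first.
  by move=> t; rewrite inE /= in_itv /= => /(geodesic_speed gc).
by rewrite Rintegral_cst //= lebesgue_measure_itv /= lte_fin ltr01 oppr0 adde0 mulr1.
Qed.

Lemma curve_length_ge0 c : 0 <= curve_length c.
Proof. by apply: Rintegral_ge0 => // t _; exact: tnorm_ge0. Qed.

Lemma path_length_ge0 x y l : path_length x y l -> 0 <= l.
Proof. by elim=> // c z l' _ _ ?; rewrite addr_ge0 // curve_length_ge0. Qed.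

Lemma dist_le_path x y l : path_length x y l -> dist x y <= l.
Proof.
by move=> xyl; apply: ge_inf => //; exists 0 => k /=; exact: path_length_ge0.
Qed.

Context (Exp : M -> 'rV[R]_n -> M) (Log : M -> M -> 'rV[R]_n).
Hypothesis hExp : exponential_map Exp.
Hypothesis hLog : inverse_exponential Exp Log.
Notation geo := (geo Exp Log).

Lemma tnorm_Log x y : tnorm x (Log x y) = dist x y.
Proof. by have [] := hLog x y. Qed.

Lemma dist_ge0 x y : 0 <= dist x y.
Proof. by rewrite -tnorm_Log tnorm_ge0. Qed.

(** The reparametrization of a geodesic by a factor t has t times the initial
    velocity, so the exponential map retraces the geodesic whose initial velocity
    is the logarithm. *)
Lemma geo_geodesic x y : [/\ geodesic (geo x y), geo x y 0 = x, geo x y 1 = y &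
  velocity (geo x y) 0 = Log x y].
Proof.
have [[c [[e e0 gc] cx cv]] Exy _ _] := hLog x y.
have gE t : - e < t < 1 + e -> c t = geo x y t.
  move=> /andP[t0 t1].
  have gct : geodesic (fun s => c (0 + t * s)).
    by apply: geodesic_affine gc _ _; apply/andP; split; lra.
  have := hExp gct; rewrite geodesic_velocity_affine; last first.
    by apply: gc; apply/andP; split; lra.
  by rewrite !(mulr0, add0r, mulr1) cx cv.
have gN t : - e < t < 1 + e -> \forall s \near t, c s = geo x y s.
  move=> te; have : t \in `]- e, 1 + e[ by rewrite in_itv.
  by move=> /near_in_itvoo; apply: filterS => s; rewrite in_itv => /gE.
have g0 : geo x y 0 = x by rewrite -gE ?cx//; apply/andP; split; lra.
have h0 : - e < 0 < 1 + e by apply/andP; split; lra.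
split.
- exists e => // t te; apply: geodesic_at_near_eq (gc _ te); exact: gN.
- exact: g0.
- by rewrite /Defs.geo scale1r.
rewrite -cv /velocity; apply/esym.
rewrite (@near_eq_derive _ _ _ _ (chart (geo x y 0) \o geo x y))//.
near=> s; rewrite /= (gE 0)//; congr chart; near: s; exact: gN.
Unshelve. all: by end_near. Qed.

Lemma Log_unique c : geodesic c ->
  tnorm (c 0) (velocity c 0) = dist (c 0) (c 1) -> velocity c 0 = Log (c 0) (c 1).
Proof.
move=> gc e; have [_ _ _] := hLog (c 0) (c 1); apply => //; last exact: hExp.
by exists c.
Qed.

(** Prefixing the geodesic of the logarithm, which has length exactly the
    distance, gives the triangle inequality with no infimum to approximate. *)
Lemma path_length_dist x y z l : path_length y z l -> path_length x z (dist x y + l).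
Proof.
move=> yz; have [gg g0 g1 gv] := geo_geodesic x y.
rewrite -tnorm_Log -gv -[in X in tnorm X]g0 -geodesic_length //.
rewrite -{1}g0; apply: path_cons; first exact: geodesic_C1.
by rewrite g1.
Qed.

Lemma dist_triangle x y z : dist x z <= dist x y + dist y z.
Proof.
apply: dist_le_path; apply: path_length_dist.
by rewrite -[dist y z]addr0; apply: path_length_dist; exact: path_nil.
Qed.

Lemma dist_le_geodesic c : geodesic c ->
  dist (c 0) (c 1) <= tnorm (c 0) (velocity c 0).
Proof.
move=> gc; rewrite -geodesic_length // -[curve_length c]addr0.
apply/dist_le_path/path_cons; [exact: geodesic_C1|exact: path_nil].
Qed.

(** Reversal preserves the speed; this makes the distance symmetric and yields
    the logarithm at the far end of a geodesic. *)
Lemma geodesic_reverse c : geodesic c ->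
  let c' := (fun t => c (1 + - 1 * t)) in
  [/\ geodesic c', c' 0 = c 1, c' 1 = c 0, velocity c' 0 = - velocity c 1 &
      tnorm (c 1) (velocity c' 0) = tnorm (c 0) (velocity c 0)].
Proof.
move=> [e e0 gc] c'.
have c'0 : c' 0 = c 1 by rewrite /c' mulr0 addr0.
have v0 : velocity c' 0 = - velocity c 1.
  rewrite geodesic_velocity_affine ?scaleN1r //.
  by apply: gc; apply/andP; split; lra.
split.
- by apply: geodesic_affine gc _ _; apply/andP; split; lra.
- exact: c'0.
- by rewrite /c' mulr1 subrr.
- exact: v0.
by rewrite v0 tnormN geodesic_speed ?ler01 ?lexx//; exists e.
Qed.

Lemma dist_sym x y : dist x y = dist y x.
Proof.
wlog suff H : x y / dist x y <= dist y x.
  by apply/eqP; rewrite eq_le !H.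
have [gg g0 g1 gv] := geo_geodesic y x.
have [gg' g'0 g'1 _ nv] := geodesic_reverse gg.
have := dist_le_geodesic gg'.
by rewrite g'0 g'1 nv gv g0 g1 tnorm_Log.
Qed.

(** Both parts of a minimizing geodesic are minimizing: their lengths add up to
    the distance and, by the triangle inequality, neither can exceed the distance
    between its own end points.  Uniqueness of the logarithm does the rest. *)
Lemma Log_geo x y t : 0 <= t <= 1 -> Log x (geo x y t) = t *: Log x y.
Proof.
move=> /andP[t0 t1].
have [[e e0 gc] g0 g1 gv] := geo_geodesic x y.
set g := geo x y in gc g0 g1 gv *.
have dg s : 0 <= s <= 1 -> geodesic_at g s.
  by move=> /andP[s0 s1]; apply: gc; apply/andP; split; lra.
have gs : geodesic g by exists e.
have G1 : geodesic (fun s => g (0 + t * s)).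
  by apply: geodesic_affine gc _ _; apply/andP; split; lra.
have G2 : geodesic (fun s => g (t + (1 - t) * s)).
  by apply: geodesic_affine gc _ _; apply/andP; split; lra.
have V1 : velocity (fun s => g (0 + t * s)) 0 = t *: Log x y.
  by rewrite geodesic_velocity_affine ?gv //; apply: dg; rewrite lexx ler01.
have V2 : velocity (fun s => g (t + (1 - t) * s)) 0 = (1 - t) *: velocity g t.
  by rewrite geodesic_velocity_affine //; apply: dg; rewrite t0 t1.
have D1 := dist_le_geodesic G1; have D2 := dist_le_geodesic G2.
move: D1 D2; rewrite V1 V2 !(mulr0, addr0, add0r, mulr1) g0 addrCA subrr addr0 g1.
rewrite !tnormZ (geodesic_speed gs) ?t0 ?t1// g0 gv tnorm_Log.
rewrite (ger0_norm t0) ger0_norm ?subr_ge0// => D1 D2.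
have D3 := dist_triangle x (g t) y.
have := Log_unique G1; rewrite V1 !(mulr0, addr0, add0r, mulr1) g0; move=> <-//.
rewrite tnormZ (ger0_norm t0) tnorm_Log; apply/eqP; rewrite eq_le.
by apply/andP; split; nra.
Qed.

(** The reversed geodesic is minimizing by symmetry of the distance, hence it is
    the one that defines the logarithm. *)
Lemma velocity_geo1 x y : velocity (geo x y) 1 = - Log y x.
Proof.
have [gg g0 g1 gv] := geo_geodesic x y.
have [gg' g'0 g'1 v nv] := geodesic_reverse gg.
have := Log_unique gg'; rewrite g'0 g'1 nv g0 g1 gv tnorm_Log v => /(_ (dist_sym _ _)) <-.
by rewrite opprK.
Qed.

Context (Tr : M -> M -> 'rV[R]_n -> 'rV[R]_n).
Hypothesis hTr : parallel_transport Exp Log Tr.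

(** The field transported and the velocity are both parallel, so their inner
    product is the same at the two ends. *)
Lemma transport_Log x y v : inner y (Tr x y v) (Log y x) = - inner x v (Log x y).
Proof.
have [gg g0 g1 gv] := geo_geodesic x y.
have [V [pV V0 V1]] := hTr x y v.
have := parallel_inner (geodesic_differentiable gg) pV (velocity_parallel gg) (t := 1).
rewrite ler01 lexx => /(_ isT).
by rewrite V0 V1 gv g0 g1 velocity_geo1 innerNr => <-; rewrite opprK.
Qed.

(** g-convexity at the new point, rather than an integral of the gradient along
    the segment, bounds the decrease of f; the reversed logarithm is then
    transported back to the old point. *)
Lemma descent (f : M -> R) (L : R) x y : L_smooth Tr L f -> g_convex Log f ->
  f y <= f x + inner x (grad f x) (Log x y) + `|L| * dist x y ^+ 2.
Proof.
move=> [_ smooth] [_ conv]; have C := conv y x.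
set d := grad f y - Tr x y (grad f x).
have gE : grad f y = d + Tr x y (grad f x) by rewrite subrK.
rewrite gE innerDl transport_Log in C.
have CS : - inner y d (Log y x) <= `|L| * dist x y ^+ 2.
  rewrite -innerNl (le_trans (cauchy_schwarz _ _ _))// tnormN tnorm_Log.
  rewrite (dist_sym y) expr2 mulrA ler_wpM2r ?dist_ge0//.
  by rewrite (le_trans (smooth _ _))// ler_wpM2r ?dist_ge0// ler_norm.
lra.
Qed.

End Distance.

(** * Boundedness of the distance on compact sets *)

Section Boundedness.
Context (R : realType) (n : nat) (M : riemannian_manifold R n).
Implicit Types (p q x y z : M) (t : R) (v : 'rV[R]_n).

Lemma is_derive_segment (u v : 'rV[R]_n) t :
  is_derive t 1 (fun s : R => u + s *: v) v.
Proof.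
have d : is_derive t 1 (fun s : R => s *: v) v.
  have [d1 d2] : is_diff t (fun s : R => s *: v) (fun s : R => s *: v).
    exact: is_diff_scalel.
  apply: DeriveDef; first exact/derivable1_diffP.
  by rewrite deriveE // d2 scale1r.
by apply: is_derive_eq; rewrite add0r.
Qed.

Section Segment.
Context (p : M) (u v : 'rV[R]_n) (e : R).
Hypothesis e0 : 0 < e.
Hypothesis in_chart : forall t, - e < t < 1 + e ->
  (chart p @` dom p) (u + t *: v).
Let aff (t : R) := u + t *: v.
Definition chart_segment t := chartV p (u + t *: v).
Notation c := chart_segment.

Lemma aff_continuous t : {for t, continuous aff}.
Proof.
by apply/differentiable_continuous/derivable1_diffP;
   have [] := is_derive_segment u v t.
Qed.

Lemma segment_dom t : - e < t < 1 + e -> dom p (c t) /\ chart p (c t) = aff t.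
Proof. by rewrite /c /aff => /in_chart[x px <-]; rewrite chartK. Qed.

Lemma near_itv t : - e < t < 1 + e -> \forall s \near t, - e < s < 1 + e.
Proof.
move=> te; have : t \in `]- e, 1 + e[ by rewrite in_itv.
by move=> /near_in_itvoo; apply: filterS => s; rewrite in_itv.
Qed.

Lemma segment_continuous t : - e < t < 1 + e -> {for t, continuous c}.
Proof.
move=> /segment_dom[pt ct].
have cV : {for aff t, continuous (chartV p)}.
  by rewrite -ct; exact: chartV_continuous.
exact: (continuous_comp (@aff_continuous t) cV).
Qed.

Lemma segment_derive q t : - e < t < 1 + e -> dom q (c t) ->
  is_derive t 1 (chart q \o c) ('D_v (chart q \o chartV p) (aff t)).
Proof.
move=> te qt; have [pt ct] := segment_dom te.
have [d1 d2] := is_derive_segment u v t.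
have := @derive_comp _ _ _ aff (chart q \o chartV p) t d1.
by rewrite d2 -ct; apply; exact: transition_differentiable.
Qed.

(** In the chart of the moving point, the segment is a transition map applied to
    an affine map, and transition maps are smooth. *)
Lemma segment_C1 : near_unit (C1_at c).
Proof.
exists e => // t te; have [pt ct] := segment_dom te.
have cc := segment_continuous te.
pose P (s : R) := is_derive s 1 (chart (c t) \o c)
    ('D_v (chart (c t) \o chartV p) (aff s)).
have dn : \forall s \near (t : R), P s.
  near=> s; apply: segment_derive; first by near: s; exact: near_itv.
  by near: s; apply: near_dom => //; exact: dom_self.
split.
- exact: cc.
- by apply: filterS dn => s [].
have eqD : \forall s \near t, 'D_v (chart (c t) \o chartV p) (aff s) =
   'D_1 (chart (c t) \o c) s.
  by apply: filterS dn => s [_ ->].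
have [_ /(_ v) /= h] := transition_smooth p (c t) 1%N.
have hc : {for aff t, continuous (fun w => 'D_v (chart (c t) \o chartV p) w)}.
  by apply: h; exists (c t) => //; split => //; exact: dom_self.
apply: (continuous_near_eq eqD).
exact: (continuous_comp (@aff_continuous t) hc).
Unshelve. all: by end_near. Qed.

(** The norm is independent of the chart; in the chart p the segment has constant
    velocity v. *)
Lemma segment_speed t : - e < t < 1 + e ->
  tnorm (c t) (velocity c t) = Num.sqrt (dot (gram p (aff t)) v v).
Proof.
move=> te; have [pt ct] := segment_dom te; have cc := segment_continuous te.
have [d _] := segment_derive te (dom_self (c t)).
rewrite /tnorm (inner_components _ _ pt) (components_velocity cc pt d) ct.
suff -> : 'D_1 (chart p \o c) t = v by [].
have [_ <-] := is_derive_segment u v t; apply: derive_near_eq.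
by near=> s; have [] // : dom p (c s) /\ chart p (c s) = aff s;
   apply: segment_dom; near: s; exact: near_itv.
Unshelve. all: by end_near. Qed.

Lemma segment_length (B : R) :
  (forall t, 0 <= t <= 1 -> Num.sqrt (dot (gram p (aff t)) v v) <= B) ->
  curve_length c <= B.
Proof.
have e0' := e0; move=> hB.
have e01 (t : R) : 0 <= t <= 1 -> - e < t < 1 + e.
  by move=> /andP[? ?]; apply/andP; split; lra.
have -> : curve_length c = \int[lebesgue_measure]_(t in `[0, 1])
    Num.sqrt (dot (gram p (aff t)) v v).
  apply: eq_Rintegral => t; rewrite inE /= in_itv /= => /e01.
  exact: segment_speed.
have -> : B = \int[lebesgue_measure]_(t in `[0, 1]) (B : R).
  by rewrite Rintegral_cst //= lebesgue_measure_itv /= lte_fin ltr01 oppr0 adde0 mulr1.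
have c01 : compact `[0, 1 : R] by exact: segment_compact.
apply: le_Rintegral => //.
- apply: continuous_compact_integrable => //.
  apply: continuous_in_subspaceT => t; rewrite inE /= in_itv /= => /e01 te.
  have [pt ct] := segment_dom te.
  have dG : derivable (fun s => gram p (aff s)) t 1.
    apply/derivable_mxP => i j; have [da _] := is_derive_segment u v t.
    have := @derive_comp _ _ _ aff (fun w => gram p w i j) t da.
    by rewrite -ct => /(_ (gram_differentiable i j pt)) [].
  have dv : derivable (fun _ : R => v) t 1 by exact: derivable_cst.
  have [dd _] := is_derive_dot dG dv dv.
  move/derivable1_diffP/differentiable_continuous : dd => dd.
  exact: (continuous_comp dd (@sqrt_continuous R _)).
- by apply: continuous_compact_integrable => // t; exact: cvg_cst.
Qed.

End Segment.

Lemma compact_seq_cover (X : set M) (U : M -> set M) : compact X ->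
  (forall p, open (U p)) -> (forall p, U p p) ->
  exists F : seq M, forall x, X x -> exists2 p, p \in F & U p x.
Proof.
rewrite compact_cover => cX oU Up; have [||F _ XF] := cX M setT U.
- by move=> p _; exact: oU.
- by move=> x Xx; exists x => //; exact: Up.
by exists (finmap.enum_fset F) => x /XF[p pF Upx]; exists p.
Qed.

(** Straight segments in a chart have length bounded by the size of the metric
    coefficients, so points near p are at bounded distance from p. *)
Lemma dist_locally_bounded p :
  exists B : R, \forall q \near p, dist p q <= B.
Proof.
pose u := chart p p; have pp := dom_self p.
pose g i j := `|gram p u i j| + 1.
pose P (ij : 'I_n * 'I_n) (w : 'rV[R]_n) : Prop :=
  `|gram p w ij.1 ij.2| <= g ij.1 ij.2.
have gb : \forall w \near u, forall ij, P ij w.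
  apply: (@filter_forall _ _ P (nbhs u) _) => -[i j].
  have /differentiable_continuous gc := gram_differentiable i j pp.
  have H : \forall w \near u, ball (gram p u i j) 1 (gram p w i j).
    exact: (gc _ (nbhsx_ballx _ 1 ltr01)).
  apply: (filterS _ H) => w; rewrite /= -ball_normE /P /g /= => wu.
  rewrite -lerBlDl (le_trans (lerB_dist _ _))// distrC; exact: ltW.
(* in the ball of radius r the chart is onto and g bounds the Gram matrix *)
have [r /= r0 hr] := (nbhs_ballP _ _).1 (filterI (image_nbhs pp) gb).
pose B := Num.sqrt (\sum_i \sum_j r * g i j * r).
have cp := chart_continuous pp.
exists B; have r2 : 0 < r / 2 by rewrite divr_gt0.
have n1 : \forall q \near p, ball u (r / 2) (chart p q).
  exact: (cp _ (nbhsx_ballx u (r / 2) r2)).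
near=> q; have pq : dom p q by near: q; exact: dom_nbhs.
have uq : ball u (r / 2) (chart p q) by near: q; exact: n1.
pose v := chart p q - u.
have vr i : `|v 0 i| < r / 2.
  by rewrite !mxE distrC; have := uq.2 0 i; rewrite -ball_normE.
(* points at distance less than r / 2 leave room for t between -1 and 2 *)
have seg t : - 1 < t < 1 + 1 -> ball u r (u + t *: v).
  move=> /andP[t1 t2]; split=> // i j.
  rewrite (ord1 i) -ball_normE /= mxE opprD addNKr mxE normrN normrM.
  have t3 : `|t| < 2 by rewrite ltr_norml; apply/andP; split; lra.
  have := vr j; have := normr_ge0 (v 0 j); nra.
have inch t : - 1 < t < 1 + 1 -> (chart p @` dom p) (u + t *: v).
  by move=> /seg/hr [].
have c0 : chart_segment p u v 0 = p by rewrite /chart_segment scale0r addr0 chartK.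
have c1 : chart_segment p u v 1 = q.
  by rewrite /chart_segment scale1r addrC subrK chartK.
have sB t : 0 <= t <= 1 -> Num.sqrt (dot (gram p (u + t *: v)) v v) <= B.
  move=> /andP[t0 t1]; have [|_ gP] := hr (u + t *: v).
    by apply: seg; apply/andP; split; lra.
  apply: ler_wsqrtr; rewrite dotE; apply: ler_sum => i _; apply: ler_sum => j _.
  rewrite (le_trans (ler_norm _))// !normrM.
  have vr' k : `|v 0 k| <= r.
    by rewrite ltW // (lt_trans (vr k)) // ltr_pdivrMr // mulrDr mulr1 ltrDl.
  by apply: ler_pM => //; apply: ler_pM => //; exact: (gP (i, j)).
have L := segment_length ltr01 inch sB.
apply: (le_trans _ L); rewrite -[curve_length _]addr0.
rewrite -[in X in X <= _]c0 -[in X in X <= _]c1.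
apply: dist_le_path; apply: path_cons; last exact: path_nil.
exact: (segment_C1 ltr01 inch).
Unshelve. all: by end_near. Qed.

Context (Exp : M -> 'rV[R]_n -> M) (Log : M -> M -> 'rV[R]_n).
Hypothesis hExp : exponential_map Exp.
Hypothesis hLog : inverse_exponential Exp Log.

(** Finitely many of the neighbourhoods of [dist_locally_bounded] cover X; the
    triangle inequality through their centres bounds the distance to a base
    point. *)
Lemma compact_diameter (X : set M) : compact X ->
  exists2 D : R, 0 <= D & forall x y, X x -> X y -> dist x y <= D.
Proof.
move=> cX; have [B hB] := choice dist_locally_bounded.
pose U p := interior [set q | dist p q <= B p].
have [|x|F XF] := compact_seq_cover cX (U := U).
- by move=> p; exact: open_interior.
- exact: hB.
have B0 p : 0 <= B p.
  by apply: le_trans (nbhs_singleton (hB p)); exact: (dist_ge0 hLog).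
pose S := \sum_(p <- F) (dist point p + B p).
have S0 : 0 <= S by apply: sumr_ge0 => p _; rewrite addr_ge0 // (dist_ge0 hLog).
have XS x : X x -> dist point x <= S.
  move=> /XF[p pF /interior_subset /= Upx].
  apply: le_trans (dist_triangle hExp hLog point p x) _.
  rewrite /S (big_rem p) //= (le_trans (y := dist point p + B p)) ?lerD2l//.
  by rewrite lerDl sumr_ge0 // => z _; rewrite addr_ge0 // (dist_ge0 hLog).
exists (S + S); first exact: addr_ge0.
move=> x y /XS Sx /XS Sy; apply: le_trans (dist_triangle hExp hLog x point y) _.
by rewrite (dist_sym hExp hLog) lerD.
Qed.

End Boundedness.

(** * Riemannian gradients in an arbitrary chart *)

Lemma differentiable_near_eq (R : realType) (V W : normedModType R)
    (f g : V -> W) (x : V) : (\forall u \near x, f u = g u) ->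
  differentiable f x -> differentiable g x.
Proof.
move=> fg df; have fgx := nbhs_singleton fg.
have fg0 : \forall h \near (0 : V), f (h + x) = g (h + x).
  by move: fg; rewrite (near_shift 0 x) subr0.
have cdf : continuous ('d f x) by exact: diff_continuous.
have e : g \o shift x = cst (g x) + 'd f x +o_ (0 : V) id.
  have /eqaddoP fo := diff_locally df.
  apply/eqaddoP => eps e0; near=> h.
  have fgh : f (h + x) = g (h + x) by near: h.
  rewrite !fctE /= -fgx -fgh.
  by near: h; exact: fo.
apply/diff_locallyP; rewrite (diff_unique cdf e); split => //.
Unshelve. all: by end_near. Qed.

Section Gradient.
Context (R : realType) (n : nat) (M : riemannian_manifold R n).
Implicit Types (p q x y z : M) (f g : M -> R).

(** The coordinates in the chart p of the differential of f at x. *)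
Definition differential p f x : 'rV[R]_n :=
  \row_j partial j (f \o chartV p) (chart p x).

Lemma gradE f x : grad f x = differential x f x *m invmx (gram x (chart x x)).
Proof. by []. Qed.

Lemma mdifferentiable_in_chart f p x : dom p x -> mdifferentiable f x ->
  differentiable (f \o chartV p) (chart p x).
Proof.
move=> px df.
have xx := dom_self x.
have dt := transition_differentiable px xx.
have dft : differentiable ((f \o chartV x) \o (chart x \o chartV p)) (chart p x).
  by apply: differentiable_comp => //=; rewrite chartK.
have E : \forall u \near chart p x,
    (f \o chartV p) u = ((f \o chartV x) \o (chart x \o chartV p)) u.
  have cV : {for chart p x, continuous (chartV p)} by exact: chartV_continuous.
  have h : \forall u \near chart p x, dom x (chartV p u).
    by apply: cV; rewrite chartK //; exact: dom_nbhs.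
  by apply: filterS h => u xu; rewrite /= chartK.
by apply: differentiable_near_eq dft; apply: filterS E.
Qed.

(** Covectors transform by the transposed Jacobian matrix of the transition map. *)
Lemma differential_change f p x : dom p x -> mdifferentiable f x ->
  differential x f x =
  differential p f x *m ('J (chart p \o chartV x) (chart x x))^T.
Proof.
move=> px df; have xx := dom_self x.
have dfp := mdifferentiable_in_chart px df.
have dt := transition_differentiable xx px.
have cV : {for chart x x, continuous (chartV x)} by exact: chartV_continuous.
have h : \forall u \near chart x x, dom p (chartV x u).
  by apply: cV; rewrite chartK //; exact: dom_nbhs.
have E : \forall u \near chart x x,
    (f \o chartV x) u = ((f \o chartV p) \o (chart p \o chartV x)) u.
  by apply: filterS h => u pu; rewrite /= chartK.
apply/rowP => j; rewrite mxE [RHS]mxE /partial (near_eq_derive _ E).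
have dfp' : differentiable (f \o chartV p) ((chart p \o chartV x) (chart x x)).
  by rewrite /= chartK.
rewrite deriveE; last exact: differentiable_comp.
rewrite diff_comp //= -(deriveE _ dt) (deriveEjacobian _ dt) chartK //.
rewrite -rowE.
rewrite [X in 'd _ _ X]row_sum_delta linear_sum /=; apply: eq_bigr => k _.
by rewrite linearZ /= !mxE /partial deriveE // mulrC.
Qed.

(** The metric is a bilinear form, so the Gram matrix transforms by congruence. *)
Lemma gram_change p x : dom p x ->
  gram x (chart x x) = 'J (chart p \o chartV x) (chart x x) *m
    gram p (chart p x) *m ('J (chart p \o chartV x) (chart x x))^T.
Proof.
move=> px; have xx := dom_self x; set J := 'J _ _.
have dt := transition_differentiable xx px.
have D G i j : dot G (delta_mx 0 i) (delta_mx 0 j) = G i j :> R.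
  by rewrite /dot -rowE trmx_delta -colE !mxE.
apply/matrixP => i j; rewrite -D (gram_transition _ _ xx px) !(deriveEjacobian _ dt).
by rewrite -/J -[RHS]D /dot !trmx_mul !mulmxA.
Qed.

(** The pairing of two gradients is the dual metric applied to the
    differentials, and this expression has the same value in every chart. *)
Lemma inner_grad p f g x : dom p x -> mdifferentiable f x -> mdifferentiable g x ->
  inner x (grad f x) (grad g x) =
  dot (invmx (gram p (chart p x))) (differential p f x) (differential p g x).
Proof.
move=> px df dg; rewrite !gradE /inner.
have Gu := gram_unit (dom_self x); have Gs := gram_sym (dom_self x).
have Gc := gram_change px; have Gpu := gram_unit px.
rewrite (differential_change px df) (differential_change px dg).
set J := 'J _ _ in Gc *; set G := gram x _ in Gu Gs Gc *.
set Gp := gram p _ in Gc Gpu *; set a := differential p f x.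
set b := differential p g x.
have Ju : J \in unitmx.
  by move: Gu; rewrite Gc unitmx_mul => /andP[]; rewrite unitmx_mul => /andP[].
have JTu : J^T \in unitmx by rewrite unitmx_tr.
have iG : invmx G = invmx J^T *m invmx Gp *m invmx J.
  have GiG : G *m (invmx J^T *m invmx Gp *m invmx J) = 1%:M.
    rewrite Gc !mulmxA -(mulmxA _ J^T) mulmxV // mulmx1 -(mulmxA J) mulmxV // mulmx1.
    by rewrite mulmxV.
  by rewrite -[LHS]mulmx1 -GiG mulmxA mulVmx // mul1mx.
rewrite /dot !trmx_mul trmxK trmx_inv Gs.
rewrite -!mulmxA (mulmxA G) mulmxV // mul1mx iG !mulmxA.
by rewrite -(mulmxA a) mulmxV // mulmx1 -(mulmxA _ (invmx J)) mulVmx // mulmx1.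
Qed.

End Gradient.

(** * Measurability of gradients *)

Section MatrixMeasurability.
Context d (T : measurableType d) (R : realType) (D : set T).

Lemma measurable_det m (A : T -> 'M[R]_m) :
  (forall i j, measurable_fun D (fun x => A x i j)) ->
  measurable_fun D (fun x => \det (A x)).
Proof.
move=> mA; rewrite /determinant; apply: measurable_sum => s.
apply: measurable_funM; first exact: measurable_cst.
by apply: measurable_prod => i _; exact: mA.
Qed.

Lemma measurable_inv (f : T -> R) : measurable D -> (forall x, D x -> f x != 0) ->
  measurable_fun D f -> measurable_fun D (fun x => (f x)^-1).
Proof.
move=> mD f0 mf.
have o0 : open [set x : R | x != 0].
  rewrite (_ : [set _ | _] = ~` [set 0]); last first.
    by apply/seteqP; split => x /= /eqP.
  by apply: closed_openC; exact: closed_eq.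
apply: (@measurable_comp _ _ _ _ _ _ [set x : R | x != 0] (fun x => x^-1)) => //.
- exact: open_measurable.
- by move=> _ [x Dx <-] /=; exact: f0.
apply: open_continuous_measurable_fun => // x; rewrite inE /= => x0.
exact: inv_continuous.
Qed.

(** By Cramer's rule the entries are quotients of determinants. *)
Lemma measurable_invmx m (A : T -> 'M[R]_m) : measurable D ->
  (forall x, D x -> A x \in unitmx) ->
  (forall i j, measurable_fun D (fun x => A x i j)) ->
  forall i j, measurable_fun D (fun x => invmx (A x) i j).
Proof.
move=> mD uA mA i j.
apply: (eq_measurable_fun (fun x => (\det (A x))^-1 * cofactor (A x) j i)).
  by move=> x; rewrite inE => Dx; rewrite /invmx uA // !mxE.
apply: measurable_funM.
  apply: measurable_inv => //; first by move=> x /uA; rewrite unitmxE unitfE.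
  exact: measurable_det.
apply: measurable_funM; first exact: measurable_cst.
apply: measurable_det => k l.
apply: (eq_measurable_fun (fun x => A x (lift j k) (lift i l))) => //.
by move=> x _; rewrite !mxE.
Qed.

Lemma measurable_dot m (A : T -> 'M[R]_m) (a b : T -> 'rV[R]_m) :
  (forall i j, measurable_fun D (fun x => A x i j)) ->
  (forall j, measurable_fun D (fun x => a x 0 j)) ->
  (forall j, measurable_fun D (fun x => b x 0 j)) ->
  measurable_fun D (fun x => dot (A x) (a x) (b x)).
Proof.
move=> mA ma mb.
rewrite (_ : (fun x => _) =
  (fun x => \sum_i \sum_j a x 0 i * A x i j * b x 0 j)); last first.
  by apply/funext => x; rewrite dotE.
apply: measurable_sum => i; apply: measurable_sum => j.
by apply: measurable_funM; first exact: measurable_funM.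
Qed.

End MatrixMeasurability.

Section BorelManifold.
Context (R : realType) (n : nat) (M : riemannian_manifold R n).
Implicit Types (p x y z : M).

Lemma borel_open (U : set M) : open U -> measurable (U : set (borel M)).
Proof. exact: sub_sigma_algebra. Qed.

Lemma borel_compact (X : set M) : compact X -> measurable (X : set (borel M)).
Proof.
move=> /(compact_closed (@carrier_hausdorff _ _ M)) cX.
rewrite -[X]setCK; apply: measurableC; apply: borel_open; exact: closed_openC.
Qed.

(** The Borel sets of the manifold are generated by its open sets, and those of
    the real line by the open intervals. *)
Lemma measurable_borel_open (D : set M) (f : M -> R) : open D ->
  (forall x, D x -> {for x, continuous f}) ->
  measurable_fun (D : set (borel M)) (f : borel M -> R).
Proof.
move=> oD cf; apply: (measurability _ (RGenOpens.measurableE R)).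
move=> _ [_ [a [b ->] <-]]; apply: borel_open.
rewrite openE => x /= [Dx fx]; rewrite /interior.
apply: filterI; first by apply: open_nbhs_nbhs; split.
by apply: (cf _ Dx); apply: open_nbhs_nbhs; split => //; exact: interval_open.
Qed.

Lemma measurable_borel_continuous (f : M -> R) : continuous f ->
  measurable_fun setT (f : borel M -> R).
Proof.
move=> cf; apply: measurable_borel_open; first exact: openT.
by move=> x _; exact: cf.
Qed.

Lemma mdifferentiable_continuous (f : M -> R) x :
  mdifferentiable f x -> {for x, continuous f}.
Proof.
move=> /differentiable_continuous cf.
have cc := chart_continuous (dom_self x).
have := continuous_comp cc cf.
rewrite /prop_for /continuous_at /= chartK; last exact: dom_self.
apply: cvg_trans; apply: near_eq_cvg.
by apply: filterS (dom_nbhs (dom_self x)) => y xy; rewrite /= chartK.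
Qed.

(** Leaving a point in place where the chart does not reach makes the map total
    and measurable. *)
Definition coordinate_shift p (v : 'rV[R]_n) x : M :=
  if `[< dom p x /\ (chart p @` dom p) (chart p x + v) >]
  then chartV p (chart p x + v) else x.

(** The map is continuous on the open set where the chart allows the shift, and
    the identity elsewhere. *)
Lemma measurable_coordinate_shift p v :
  measurable_fun setT (coordinate_shift p v : borel M -> borel M).
Proof.
pose D := [set x | dom p x /\ (chart p @` dom p) (chart p x + v)].
have cs x : dom p x -> {for x, continuous (fun x => chart p x + v)}.
  by move=> px; apply: cvgD; [exact: chart_continuous|exact: cvg_cst].
have oD (U : set M) : open U -> open (D `&` (fun x => chartV p (chart p x + v)) @^-1` U).
  move=> oU; rewrite openE => x /= [[px [y py E]] Ux]; rewrite /interior.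
  have cx := cs _ px.
  apply: filterI; first apply: filterI.
  - exact: dom_nbhs.
  - by apply: cx; rewrite -E; exact: image_nbhs.
  have cV : {for chart p x + v, continuous (chartV p)}.
    by rewrite -E; exact: chartV_continuous.
  by apply: (continuous_comp cx cV); apply: open_nbhs_nbhs.
apply: (@measurability _ _ _ (borel M) setT _ (@open M) erefl).
move=> _ [U oU <-]; rewrite setTI.
rewrite (_ : _ @^-1` _ =
  (D `&` (fun x => chartV p (chart p x + v)) @^-1` U) `|` (~` D `&` U)).
  apply: measurableU; first by apply: borel_open; exact: oD.
  apply: measurableI; last exact: borel_open.
  apply: measurableC; apply: borel_open.
  by have := oD setT openT; rewrite preimage_setT setIT.
apply/seteqP; split => x /=; rewrite /coordinate_shift.
  by case: asboolP => h; [left|right].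
by case: asboolP => h [[h' ?]|[h' ?]].
Qed.

Section Family.
Context d (S : measurableType d) (psi : M -> S -> R).
Hypothesis mpsi : measurable_fun setT (fun q : borel M * S => psi q.1 q.2).
Hypothesis dpsi : forall s x, mdifferentiable (psi^~ s) x.

Definition chart_cylinder p : set (borel M * S) :=
  (dom p : set (borel M)) `*` setT.

Lemma measurable_chart_cylinder p : measurable (chart_cylinder p).
Proof. by apply: measurableX => //; apply: borel_open; exact: dom_open. Qed.

(** A partial derivative is a limit of difference quotients, each of which is
    jointly measurable in the point and the parameter. *)
Lemma measurable_differential p j :
  measurable_fun (chart_cylinder p)
    (fun q => differential p (psi^~ q.2) q.1 0 j).
Proof.
pose h k : R := k.+1%:R^-1.
pose v k : 'rV[R]_n := h k *: delta_mx 0 j.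
pose F k (q : borel M * S) :=
  (h k)^-1 * (psi (coordinate_shift p (v k) q.1) q.2 - psi q.1 q.2).
have mF k : measurable_fun (chart_cylinder p) (F k).
  apply: measurable_funTS; apply: measurable_funM; first exact: measurable_cst.
  apply: measurable_funB; last exact: mpsi.
  have mq : measurable_fun setT (fun q : borel M * S =>
     ((coordinate_shift p (v k) q.1 : borel M), q.2)).
    apply: measurable_fun_pair; last exact: measurable_snd.
    apply: (measurableT_comp (measurable_coordinate_shift p (v k))).
    exact: measurable_fst.
  exact: (measurableT_comp mpsi mq).
apply: (measurable_fun_cvg mF) => -[x s] /= [px _].
rewrite mxE /partial.
have df := mdifferentiable_in_chart px (dpsi s x).
have cG : derivable (psi^~ s \o chartV p) (chart p x) (delta_mx 0 j).
  exact: diff_derivable.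
rewrite /derivable in cG; rewrite /derive /=; set G := (fun t : R => _) in cG *.
have hk : h k @[k --> \oo] --> (0 : R)^'.
  move=> A A0; have h0 : \forall k \near \oo, h k != 0 -> A (h k).
    exact: (@cvg_harmonic R _ A0).
  by apply: filterS h0 => k; apply; rewrite /h invr_neq0.
have cF := cvg_comp h G hk cG.
apply: cvg_trans cF; apply: near_eq_cvg.
have cs : {for (0 : R), continuous (fun t : R => chart p x + t *: delta_mx 0 j)}.
  by apply/differentiable_continuous/derivable1_diffP;
     have [] := is_derive_segment (chart p x) (delta_mx 0 j) 0.
have im : \forall k \near \oo, (chart p @` dom p) (chart p x + v k).
  have im0 : nbhs (chart p x + 0 *: delta_mx 0 j) (chart p @` dom p).
    by rewrite scale0r addr0; exact: image_nbhs.
  exact: (@cvg_harmonic R _ (cs _ im0)).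
apply: filterS im => k im.
rewrite /F /G /= /coordinate_shift asboolT; last by split.
by rewrite chartK // [v k + _]addrC.
Qed.

End Family.
End BorelManifold.

(** * Independence and integrals *)

Section Independence.
Context d0 (Omega : measurableType d0) (R : realType) (Pr : probability Omega R).

(** The sets that satisfy the product rule with W form a lambda-system, so
    Dynkin's theorem applies to a generating family closed under intersection. *)
Lemma independent_generated d (T : measurableType d) (U : Omega -> T)
    (G : set (set T)) (W : set Omega) :
  measurable_fun setT U -> measurable W ->
  @measurable _ T = <<s G >> -> setI_closed G ->
  (forall A, G A -> Pr (U @^-1` A `&` W) = (Pr (U @^-1` A) * Pr W)%E) ->
  forall A, measurable A -> Pr (U @^-1` A `&` W) = (Pr (U @^-1` A) * Pr W)%E.
Proof.
move=> mU mW GE GI indG A; rewrite GE.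
have mUA B : measurable B -> measurable (U @^-1` B).
  by move=> mB; rewrite -[X in measurable X]setTI; exact: mU.
have fP B : measurable B -> Pr B \is a fin_num by move=> mB; exact: fin_num_measure.
apply: (@dynkin_induction _ T G
  (fun A => Pr (U @^-1` A `&` W) = (Pr (U @^-1` A) * Pr W)%E) GE GI) => //.
- by rewrite preimage_setT setTI probability_setT mul1e.
- move=> B mB eB; rewrite (_ : U @^-1` (~` B) = ~` (U @^-1` B)) // setIC -setDE.
  have -> : Pr (W `\` U @^-1` B) = (Pr W - Pr (W `&` U @^-1` B))%E.
    by apply: measureD => //; [exact: mUA|rewrite ltey_eq fP].
  rewrite [W `&` _]setIC eB.
  rewrite probability_setC; last exact: mUA.
  have fB := fP _ (mUA _ mB); have fW := fP _ mW.
  by rewrite muleBl ?mul1e // fin_num_adde_defl.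
move=> F mF tF eF; rewrite preimage_bigcup setI_bigcupl.
have tU : trivIset setT (fun n => U @^-1` F n) 
  by move=> i j _ _ [w [Fi Fj]]; apply: tF => //; exists (U w).
rewrite measure_bigcup //; last 2 first.
- by move=> n _; apply: measurableI => //; exact: mUA.
- by move=> i j _ _ [w [[Fi _] [Fj _]]]; apply: tF => //; exists (U w).
rewrite measure_bigcup //; last by move=> n _; exact: mUA.
have qE : Pr W = (fine (Pr W))%:E by rewrite fineK // fP.
rewrite qE [RHS]muleC -nneseriesZl //.
by apply: eq_eseriesr => n _; rewrite -qE muleC; exact: eF.
Qed.

Lemma bounded_integrable d (T : measurableType d) (P : probability T R)
    (f : T -> R) (c : R) : measurable_fun setT f -> (forall x, `|f x| <= c) ->
  P.-integrable setT (EFin \o f).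
Proof.
move=> mf fc; apply: measurable_bounded_integrable => //.
  by apply: (@le_lt_trans _ _ 1%E); [exact: probability_le1|exact: ltry].
exists c; split; first exact: num_real.
by move=> e ce x _; exact: (le_trans (fc x) (ltW ce)).
Qed.

Lemma probability_integral_cst d (T : measurableType d) (P : probability T R)
  (r : R) : (\int[P]_x r%:E = r%:E)%E.
Proof. by rewrite integral_cst // [X in (_ * X)%E]probability_setT mule1. Qed.

Section Means.
Context d (T : measurableType d) (P : probability T R).

Lemma EFin_Rintegral (f : T -> R) : P.-integrable setT (EFin \o f) ->
  ((\int[P]_x f x)%:E = \int[P]_x (f x)%:E)%E.
Proof. by move=> fi; rewrite /Rintegral fineK //; exact: integrable_fin_num. Qed.

Lemma Rintegral_sum m (f : 'I_m -> T -> R) :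
  (forall i, P.-integrable setT (EFin \o f i)) ->
  P.-integrable setT (EFin \o (fun x => \sum_i f i x)) /\
  \int[P]_x (\sum_i f i x) = \sum_i \int[P]_x f i x.
Proof.
move=> fi.
have E : EFin \o (fun x => \sum_i f i x) = (fun x => \sum_i (f i x)%:E)%E.
  by apply/funext => x; rewrite /= sumEFin.
have iS : P.-integrable setT (EFin \o (fun x => \sum_i f i x)).
  by rewrite E; apply: integrable_sum => // i _; exact: fi.
split => //; apply: EFin_inj; rewrite EFin_Rintegral // -sumEFin.
transitivity (\int[P]_x (\sum_i (f i x)%:E))%E.
  by apply: eq_integral => x _; rewrite sumEFin.
rewrite integral_sum //.
by apply: eq_bigr => i _; rewrite EFin_Rintegral.
Qed.

(** The almost sure form is needed because the bound on the stochastic gradients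
    holds for samples in the support only. *)
Lemma Rintegral_ae_le (f g : T -> R) (N : set T) :
  P.-integrable setT (EFin \o f) -> P.-integrable setT (EFin \o g) ->
  measurable N -> P N = 0%E -> (forall x, ~ N x -> f x <= g x) ->
  \int[P]_x f x <= \int[P]_x g x.
Proof.
move=> fi gi mN N0 fg; rewrite -lee_fin !EFin_Rintegral //.
rewrite (negligible_integral mN) // (negligible_integral mN _ gi) //.
have mD : measurable (setT `\` N) by exact: measurableD.
apply: le_integral => //.
- exact: integrableS fi.
- exact: integrableS gi.
by move=> x; rewrite inE => -[_ Nx]; rewrite lee_fin fg.
Qed.

End Means.

Section Pair.
Context d1 d2 (T1 : measurableType d1) (T2 : measurableType d2).
Context (Q : probability T2 R) (U : Omega -> T1) (V : Omega -> T2).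
Hypothesis mU : measurable_fun setT U.
Hypothesis mV : measurable_fun setT V.
Hypothesis indUV : forall A B, measurable A -> measurable B ->
  Pr (U @^-1` A `&` V @^-1` B) = (Pr (U @^-1` A) * Q B)%E.

(** The joint law of independent variables is a product measure, so Fubini
    applies. *)
Lemma integral_independent (H : T1 * T2 -> R) (c : R) :
  measurable_fun setT H -> (forall w, `|H w| <= c) ->
  (\int[Pr]_w (H (U w, V w))%:E = \int[Pr]_w \int[Q]_v (H (U w, v))%:E)%E.
Proof.
move=> mH Hc.
have mUV : measurable_fun setT (fun w => (U w, V w)) by exact: measurable_fun_pair.
pose U' : {mfun Omega >-> T1} := mfun_Sub (mem_set mU).
pose UV' : {mfun Omega >-> (T1 * T2)%type} := mfun_Sub (mem_set mUV).
have mH' : measurable_fun setT (EFin \o H) by exact/measurable_EFinP.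
have iH : (distribution Pr U' \x Q)%E.-integrable setT (EFin \o H).
  exact: bounded_integrable Hc.
transitivity (\int[distribution Pr UV']_z (H z)%:E)%E.
  rewrite integral_distribution //.
  apply: (@bounded_integrable _ _ _ (H \o UV') c).
    exact: (measurableT_comp mH mUV).
  by move=> w; exact: Hc.
transitivity (\int[(distribution Pr U' \x Q)%E]_z (H z)%:E)%E.
  apply: eq_measure_integral => A mA _.
  apply/esym/product_measure_unique => // B C mB mC; exact: indUV.
rewrite -(integral12_prod_meas1 iH) integral_distribution //.
  exact: (measurable_fubini_F iH).
apply: (@le_integrable _ _ _ _ _ _ _ (cst c%:E)) => //.
- have mF := measurable_fubini_F iH.
  exact: (measurableT_comp mF).
- move=> w _; have c0 : 0 <= c by exact: le_trans (Hc point).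
  have mHw : measurable_fun setT (fun v => (H (U w, v))%:E).
    by apply: (measurableT_comp mH'); exact: pair1_measurable.
  rewrite /= /fubini_F; apply: le_trans (le_abse_integral _ _ _) _ => //.
  have -> : `|c|%:E = (\int[Q]_v c%:E)%E.
    by rewrite probability_integral_cst ger0_norm.
  apply: ge0_le_integral => //; first exact: measurableT_comp.
  by move=> v _; rewrite /= lee_fin.
by apply/(@bounded_integrable _ _ _ (cst c) `|c|).
Qed.

End Pair.
(** The event is encoded as a Boolean random variable, which reduces the claim to
    Fubini's theorem for a pair of independent variables. *)
Lemma Rintegral_independent_event d (T : measurableType d) (U : Omega -> T)
    (D : set Omega) (q : R) (f : T -> R) (c : R) :
  measurable_fun setT U -> measurable D ->
  (forall A, measurable A -> Pr (D `&` U @^-1` A) = (q%:E * Pr (U @^-1` A))%E) ->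
  measurable_fun setT f -> (forall u, `|f u| <= c) ->
  \int[Pr]_w (\1_D w * f (U w)) = q * \int[Pr]_w f (U w).
Proof.
move=> mU mD ind mf fc.
have PD : Pr D = q%:E.
  by have := ind setT measurableT; rewrite preimage_setT setIT probability_setT mule1.
pose V w := w \in D.
have VT : V @^-1` [set true] = D.
  by apply/seteqP; split => w /= => [/set_mem//|/mem_set].
have VF : V @^-1` [set false] = ~` D.
  apply/seteqP; split => w /=; first by move=> /negbT nw Dw; move: nw; rewrite /V mem_set.
  by move=> nD; rewrite /V memNset.
have mUA A : measurable A -> measurable (U @^-1` A).
  by move=> mA; rewrite -[X in measurable X]setTI; exact: mU.
have mV : measurable_fun setT V.
  by apply: (measurable_fun_bool true); rewrite setTI VT.
pose V' : {mfun Omega >-> bool} := mfun_Sub (mem_set mV).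
have UV A B : measurable A -> measurable B ->
    Pr (U @^-1` A `&` V @^-1` B) = (Pr (U @^-1` A) * distribution Pr V' B)%E.
  move=> mA _; have mUAA := mUA _ mA.
  rewrite -[distribution Pr V' B]/(Pr (V @^-1` B)).
  have iT : Pr (U @^-1` A `&` D) = (Pr (U @^-1` A) * q%:E)%E.
    by rewrite setIC ind // muleC.
  have [|||] := set_bool B => /eqP ->.
  - by rewrite VT iT PD.
  - rewrite VF -setDE.
    have -> : Pr (U @^-1` A `\` D) = (Pr (U @^-1` A) - Pr (U @^-1` A `&` D))%E.
      by apply: measureD => //; rewrite ltey_eq fin_num_measure.
    rewrite iT probability_setC // PD -EFinB.
    have fA : Pr (U @^-1` A) \is a fin_num by exact: fin_num_measure.
    by rewrite -(fineK fA) -!EFinM -EFinB mulrBr mulr1.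
  - by rewrite preimage_set0 setI0 measure0 mule0.
  - by rewrite preimage_setT setIT probability_setT mule1.
pose H (z : T * bool) := z.2%:R * f z.1.
have mb : measurable_fun setT (fun t : bool => t%:R : R) by [].
have mH : measurable_fun setT H.
  apply: measurable_funM; first by apply: (measurableT_comp mb); exact: measurable_snd.
  by apply: (measurableT_comp mf); exact: measurable_fst.
have Hc z : `|H z| <= c.
  rewrite /H normrM; case: (z.2); first by rewrite normr1 mul1r.
  by rewrite normr0 mul0r (le_trans _ (fc z.1)).
have mfU : measurable_fun setT (fun w => f (U w)) by exact: measurableT_comp.
have ifU : Pr.-integrable setT (EFin \o (fun w => f (U w))).
  by apply: (bounded_integrable _ mfU) => w; exact: fc.
have eI := integral_independent mU mV UV mH Hc.
rewrite -RintegralZl //; congr fine.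
transitivity (\int[Pr]_w (H (U w, V w))%:E)%E.
  by apply: eq_integral => w _; rewrite indicE.
rewrite eI; apply: eq_integral => w _.
have -> : (fun v => (H (U w, v))%:E) = (fun v : bool => (f (U w))%:E * (v%:R)%:E)%E.
  by apply/funext => v; rewrite /H /= -EFinM mulrC.
have mbE : measurable_fun setT (fun t : bool => (t%:R : R)%:E) by [].
have -> : (\int[distribution Pr V']_v ((f (U w))%:E * (v%:R)%:E))%E =
   ((f (U w))%:E * \int[distribution Pr V']_v (v%:R)%:E)%E.
  apply: integralZl => //.
  apply: (@bounded_integrable _ _ _ (fun t : bool => t%:R : R) 1) => // t.
  by case: t; rewrite ?normr1 ?normr0.
rewrite ge0_integral_distribution //.
transitivity ((f (U w))%:E * Pr D)%E; last by rewrite PD -EFinM mulrC.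
congr (_ * _)%E; rewrite -[D in RHS]setIT -integral_indic //.
Qed.

End Independence.

(** * Measurability of the pairing of gradients *)

Section GradientPairing.
Context (R : realType) (n : nat) (M : riemannian_manifold R n).
Implicit Types (p x y z : M).

Lemma gradB (f g : M -> R) x : mdifferentiable f x -> mdifferentiable g x ->
  grad (fun y => f y - g y) x = grad f x - grad g x.
Proof.
move=> df dg; rewrite !gradE -mulmxBl; congr (_ *m _).
apply/rowP => j; rewrite !mxE /partial.
have -> : (fun y => f y - g y) \o chartV x = (f \o chartV x) - (g \o chartV x).
  by apply/funext => u.
by rewrite deriveB //; apply: diff_derivable.
Qed.

Lemma mdifferentiableB (f g : M -> R) x : mdifferentiable f x -> mdifferentiable g x ->
  mdifferentiable (fun y => f y - g y) x.
Proof. by move=> df dg; exact: (differentiableB df dg). Qed.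

(** Finitely many charts cover a compact set, and in each of them the pairing is
    an algebraic expression in measurable functions. *)
Lemma measurable_inner_grad d (S : measurableType d) (X : set M)
    (psi1 psi2 : M -> S -> R) : compact X ->
  measurable_fun setT (fun q : borel M * S => psi1 q.1 q.2) ->
  measurable_fun setT (fun q : borel M * S => psi2 q.1 q.2) ->
  (forall s x, mdifferentiable (psi1^~ s) x) ->
  (forall s x, mdifferentiable (psi2^~ s) x) ->
  measurable_fun ((X : set (borel M)) `*` [set: S])
    (fun q : borel M * S => inner q.1 (grad (psi1^~ q.2) q.1) (grad (psi2^~ q.2) q.1)).
Proof.
move=> cX m1 m2 d1 d2.
have [||F XF] := compact_seq_cover cX (U := @dom R n M).
- exact: dom_open.
- exact: dom_self.
(* indices past the end of F repeat the chart around the default point *)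
pose D i : set (borel M * S) := chart_cylinder (nth point F i : M).
have mD i : measurable (D i) by exact: measurable_chart_cylinder.
pose f (q : borel M * S) := inner q.1 (grad (psi1^~ q.2) q.1) (grad (psi2^~ q.2) q.1).
suff mf : measurable_fun (\bigcup_i D i) f.
  apply: measurable_funS mf; first exact: bigcup_measurable.
  move=> [x s] [/= Xx _]; have [p pF px] := XF x Xx.
  by exists (index p F) => //; split => //=; rewrite nth_index.
apply/(measurable_fun_bigcup f mD) => i; rewrite /D.
set p := nth point F i; rewrite /f.
apply: (eq_measurable_fun (fun q : borel M * S =>
   dot (invmx (gram p (chart p q.1))) (differential p (psi1^~ q.2) q.1)
     (differential p (psi2^~ q.2) q.1))).
  by move=> [x s]; rewrite inE => -[/= px _]; rewrite (inner_grad px).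
apply: measurable_dot.
- apply: measurable_invmx; first exact: measurable_chart_cylinder.
    by move=> [x s] [/= px _]; exact: gram_unit.
  move=> k l.
  pose gkl (x : borel M) := gram p (chart p x) k l.
  have mg : measurable_fun (dom p : set (borel M)) gkl.
    apply: measurable_borel_open; first exact: dom_open.
    move=> x px; have /differentiable_continuous gc := gram_differentiable k l px.
    exact: (continuous_comp (chart_continuous px) gc).
  apply: (@measurable_comp _ _ _ _ _ _ (dom p : set (borel M)) gkl).
  + by apply: borel_open; exact: dom_open.
  + by move=> _ [[x s] [px _] <-].
  + exact: mg.
  + by apply: measurable_funTS; exact: measurable_fst.
- by move=> j; exact: measurable_differential.
- by move=> j; exact: measurable_differential.
Qed.

End GradientPairing.

(** * Gradient noise *)

Section Noise.
Context (R : realType) (n : nat) (M : riemannian_manifold R n).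
Context (dXi : measure_display) (Xi : measurableType dXi) (P : probability Xi R).
Context (phi : M -> Xi -> R) (hphi : stochastic_objective P phi).
Hypothesis hunb : unbiased P phi.
Notation Phi := (objective P phi).
Hypothesis hdiff : forall x : M, mdifferentiable Phi x.
Context (supp : set Xi) (hsupp : measurable supp) (hsupp1 : P supp = 1%E).
Context (X : set M) (cX : compact X) (C : R).
Hypothesis hC : forall x z, X x -> supp z -> tnorm x (stoch_grad phi x z) <= C.
Implicit Types (x : M) (z : Xi) (v : 'rV[R]_n).

Definition noise x z := stoch_grad phi x z - grad Phi x.

Lemma measurable_objective : measurable_fun setT (Phi : borel M -> R).
Proof.
by apply: measurable_borel_continuous => x; exact: mdifferentiable_continuous.
Qed.

Lemma noiseE x z : noise x z = grad (fun y => phi y z - Phi y) x.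
Proof.
by rewrite /noise /stoch_grad gradB //; have [_ _ ] := hphi; apply.
Qed.

Lemma measurable_inner_noise :
  measurable_fun ((X : set (borel M)) `*` [set: Xi * Xi])
    (fun q : borel M * (Xi * Xi) => inner q.1 (noise q.1 q.2.1) (noise q.1 q.2.2)).
Proof.
have [mphi _ dphi] := hphi.
have mi (pr : Xi * Xi -> Xi) : measurable_fun setT pr ->
    measurable_fun setT (fun q : borel M * (Xi * Xi) => phi q.1 (pr q.2) - Phi q.1).
  move=> mpr; apply: measurable_funB.
    have mq : measurable_fun setT (fun q : borel M * (Xi * Xi) => (q.1, pr q.2)).
      apply: measurable_fun_pair; first exact: measurable_fst.
      by apply: (measurableT_comp mpr); exact: measurable_snd.
    exact: (measurableT_comp mphi mq).
  by apply: (measurableT_comp measurable_objective); exact: measurable_fst.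
have di (pr : Xi * Xi -> Xi) (s : Xi * Xi) x :
    mdifferentiable (fun y => phi y (pr s) - Phi y) x.
  exact: mdifferentiableB.
have := measurable_inner_grad cX (mi fst measurable_fst) (mi snd measurable_snd)
  (di fst) (di snd).
apply: eq_measurable_fun => q _; by rewrite !noiseE.
Qed.

(** The pairing with a fixed vector v is a linear combination of components, and
    these are unbiased. *)
Lemma noise_mean x v :
  P.-integrable setT (fun z => (inner x v (noise x z))%:E) /\
  (\int[P]_z (inner x v (noise x z))%:E = 0)%E.
Proof.
pose a j := \sum_i v 0 i * gram x (chart x x) i j.
have E : (fun z => (inner x v (noise x z))%:E) =
    (fun z => \sum_j ((a j)%:E * ((stoch_grad phi x z 0 j)%:E - (grad Phi x 0 j)%:E)))%E.
  apply/funext => z; rewrite /inner dotE exchange_big /= -sumEFin.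
  apply: eq_bigr => j _; rewrite -mulr_suml EFinM -EFinB; congr (_ * (_)%:E)%E.
  by rewrite !mxE.
have iS j := (hunb x j).1.
have ic j : P.-integrable setT (fun=> (grad Phi x 0 j)%:E).
  by apply: (@bounded_integrable _ _ _ _ (cst (grad Phi x 0 j)) `|grad Phi x 0 j|).
have iB j := integrableB measurableT (iS j) (ic j).
have iZ j := integrableZl measurableT (a j) (iB j).
rewrite E; split; first by apply: integrable_sum => // j _; exact: iZ.
rewrite integral_sum // big1 // => j _.
rewrite integralZl // integralB // probability_integral_cst.
have fS : (\int[P]_z (stoch_grad phi x z 0 j)%:E)%E \is a fin_num.
  exact: integrable_fin_num.
by have := (hunb x j).2; rewrite /Rintegral => <-; rewrite fineK // subee // mule0.
Qed.

Lemma integral_supp (f : Xi -> \bar R) : P.-integrable setT f ->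
  (\int[P]_z f z = \int[P]_(z in supp) f z)%E.
Proof.
move=> fi; rewrite (negligible_integral (N := ~` supp)) //.
- by rewrite setTD setCK.
- exact: measurableC.
have h : P (~` supp) = (1 - P supp)%E by exact: probability_setC.
by rewrite hsupp1 subee in h.
Qed.

(** The gradient of the objective is the mean of the stochastic gradients.  If its
    norm exceeded C, its pairing with the noise would be at most a negative
    constant on the support and could not have mean zero. *)
Lemma objective_gradient_bound x : X x -> tnorm x (grad Phi x) <= C.
Proof.
move=> Xx; rewrite leNgt; apply/negP => Cg.
set g := grad Phi x in Cg *.
have g0 : 0 <= tnorm x g by exact: tnorm_ge0.
have C0 : 0 <= C.
  have [z sz] : supp !=set0.
    apply/set0P; apply/eqP => s0; have := hsupp1.
    by rewrite s0 measure0 => /eqP; rewrite lt_eqF.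
  exact: le_trans (tnorm_ge0 _ _) (hC Xx sz).
pose c := tnorm x g * (C - tnorm x g).
have c0 : c < 0 by rewrite pmulr_rlt0 ?subr_lt0 // (le_lt_trans C0).
have [i0 e0] := noise_mean x g.
have : (\int[P]_(z in supp) (inner x g (noise x z))%:E <= \int[P]_(z in supp) c%:E)%E.
  apply: le_integral => //.
  - exact: integrableS i0.
  - apply: (@integrableS _ _ _ _ setT) => //.
    by apply: (@bounded_integrable _ _ _ _ (cst c) `|c|).
  move=> z; rewrite inE lee_fin /noise innerDr innerNr -/g -sqr_tnorm => sz.
  rewrite /c mulrBr expr2 lerB // (le_trans (cauchy_schwarz _ _ _)) //.
  by rewrite ler_wpM2l // hC.
rewrite -!integral_supp //; last exact: (@bounded_integrable _ _ _ _ (cst c) `|c|).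
by rewrite e0 probability_integral_cst lee_fin leNgt c0.
Qed.

Lemma tnorm_noise x z : X x -> supp z -> tnorm x (noise x z) <= 2 * C.
Proof.
move=> Xx sz; rewrite (le_trans (tnormD _ _ _)) // tnormN.
by have := hC Xx sz; have := objective_gradient_bound Xx; lra.
Qed.

(** The norms of the stochastic gradients are bounded here, so that correlations
    cut off outside this set are bounded everywhere. *)
Definition noise_domain : set ((borel M * Xi) * Xi) :=
  ((X : set (borel M)) `*` supp) `*` supp.

Definition correlation : (borel M * Xi) * Xi -> R :=
  (fun q => inner q.1.1 (noise q.1.1 q.1.2) (noise q.1.1 q.2)) \_ noise_domain.

Lemma measurable_noise_domain : measurable noise_domain.
Proof. by do 2 apply: measurableX => //; exact: borel_compact. Qed.

Lemma correlationE x z z' : X x -> supp z -> supp z' ->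
  correlation ((x, z), z') = inner x (noise x z) (noise x z').
Proof. by move=> Xx sz sz'; rewrite /correlation patchE mem_set. Qed.

Lemma measurable_correlation : measurable_fun setT correlation.
Proof.
have mD := measurable_noise_domain.
apply/(measurable_restrictT _ mD).
pose r (q : (borel M * Xi) * Xi) : borel M * (Xi * Xi) := (q.1.1, (q.1.2, q.2)).
have mr : measurable_fun setT r.
  have m1 : measurable_fun setT (fun q : (borel M * Xi) * Xi => q.1).
    exact: measurable_fst.
  apply: measurable_fun_pair.
    exact: (measurableT_comp measurable_fst m1).
  apply: measurable_fun_pair; last exact: measurable_snd.
  exact: (measurableT_comp measurable_snd m1).
apply: (@measurable_comp _ _ _ _ _ _
  ((X : set (borel M)) `*` [set: Xi * Xi]) _ _ r _ _ measurable_inner_noise).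
- by apply: measurableX => //; exact: borel_compact.
- by move=> _ [q [[Xq _] _] <-].
exact: measurable_funTS.
Qed.

Lemma correlation_bound q : `|correlation q| <= (2 * C) ^+ 2.
Proof.
rewrite /correlation patchE; case: ifPn => [|_]; last by rewrite normr0 sqr_ge0.
rewrite inE => -[[Xx sz] sz'].
have CS v w : `|inner q.1.1 v w| <= tnorm q.1.1 v * tnorm q.1.1 w.
  rewrite ler_norml cauchy_schwarz andbT lerNl -innerNl.
  by rewrite (le_trans (cauchy_schwarz _ _ _)) // tnormN.
by rewrite (le_trans (CS _ _)) // expr2 ler_pM ?tnorm_ge0 // tnorm_noise.
Qed.

(** The integral over the second sample is the mean of the pairing of the noise
    with a fixed vector. *)
Lemma correlation_mean u : (\int[P]_z (correlation (u, z))%:E = 0)%E.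
Proof.
case: u => x z.
have [[Xx sz]|nXs] := pselect (X x /\ supp z); last first.
  rewrite integral0_eq // => z' _; rewrite /correlation patchE memNset //.
  by move=> [[? ?] _]; apply: nXs.
have [i0 e0] := noise_mean x (noise x z).
rewrite -e0 [RHS]integral_supp // integral_supp; last first.
  apply: (@bounded_integrable _ _ _ _
    (fun z' => correlation ((x, z), z')) ((2 * C) ^+ 2)).
    by apply: (measurableT_comp measurable_correlation); exact: pair1_measurable.
  by move=> z'; exact: correlation_bound.
by apply: eq_integral => z'; rewrite inE => sz'; rewrite correlationE.
Qed.

End Noise.

(** * One Frank-Wolfe step *)

Section Step.
Context (R : realType) (n : nat) (M : riemannian_manifold R n).
Context (Exp : M -> 'rV[R]_n -> M) (Log : M -> M -> 'rV[R]_n)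
  (Tr : M -> M -> 'rV[R]_n -> 'rV[R]_n).
Hypothesis hExp : exponential_map Exp.
Hypothesis hLog : inverse_exponential Exp Log.
Hypothesis hTr : parallel_transport Exp Log Tr.
Context (f : M -> R) (L : R).
Hypothesis smooth : L_smooth Tr L f.
Hypothesis conv : g_convex Log f.
Context (X : set M) (D : R).
Hypothesis D0 : 0 <= D.
Hypothesis XD : forall x y, X x -> X y -> dist x y <= D.

Lemma gap_bound (C : R) x z : X x -> X z -> tnorm x (grad f x) <= C ->
  f x - f z <= C * D.
Proof.
move=> Xx Xz gC; have [_ /(_ x z)] := conv.
have : - inner x (grad f x) (Log x z) <= C * D.
  rewrite -innerNl (le_trans (cauchy_schwarz _ _ _)) // tnormN (tnorm_Log hLog).
  by rewrite ler_pM ?tnorm_ge0 ?(dist_ge0 hLog) // XD.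
lra.
Qed.

(** The direction chosen from the estimate m of the gradient is at least as good
    for m as the direction of z, and m differs from the gradient by a vector
    that is paired with two logarithms of length at most D. *)
Lemma frank_wolfe_step x y z (m : 'rV[R]_n) (t : R) :
  X x -> X y -> X z -> 0 <= t <= 1 ->
  inner x m (Log x y) <= inner x m (Log x z) ->
  t * (f x - f z) <= f x - f (geo Exp Log x y t)
    + t * (2 * D * tnorm x (m - grad f x)) + `|L| * (t * D) ^+ 2.
Proof.
move=> Xx Xy Xz t01 my; have /andP[t0 t1] := t01.
have H := descent hExp hLog hTr x (geo Exp Log x y t) smooth conv.
rewrite (Log_geo hExp hLog) // innerZr in H.
have E : dist x (geo Exp Log x y t) = t * dist x y.
  rewrite -(tnorm_Log hLog) (Log_geo hExp hLog) // tnormZ ger0_norm //.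
  by rewrite (tnorm_Log hLog).
rewrite E in H.
have D1 : (t * dist x y) ^+ 2 <= (t * D) ^+ 2.
  rewrite ler_pXn2r ?nnegrE ?mulr_ge0 ?(dist_ge0 hLog) //.
  by rewrite ler_wpM2l // XD.
have D2 := ler_wpM2l (normr_ge0 L) D1.
set d := m - grad f x.
have g : grad f x = m - d by rewrite /d opprB addrC subrK.
have CS w : X w -> `|inner x d (Log x w)| <= tnorm x d * D.
  move=> Xw; rewrite ler_norml; apply/andP; split.
    rewrite lerNl -innerNl (le_trans (cauchy_schwarz _ _ _)) // tnormN.
    by rewrite (tnorm_Log hLog) ler_wpM2l ?tnorm_ge0 // XD.
  rewrite (le_trans (cauchy_schwarz _ _ _)) //.
  by rewrite (tnorm_Log hLog) ler_wpM2l ?tnorm_ge0 // XD.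
have [_ /(_ x z) cz] := conv.
have gy : inner x (grad f x) (Log x y) <= f z - f x + 2 * D * tnorm x d.
  move: cz; rewrite g !innerDl !innerNl.
  have /ler_normlP[Cy _] := CS y Xy; have /ler_normlP[_ Cz] := CS z Xz.
  by lra.
have := ler_wpM2l t0 gy; rewrite mulrDr mulrBr; lra.
Qed.

End Step.

(** * The run of the algorithm *)

Section Run.
Context (R : realType) (n : nat) (M : riemannian_manifold R n).
Context (Exp : M -> 'rV[R]_n -> M) (Log : M -> M -> 'rV[R]_n).
Context (dXi : measure_display) (Xi : measurableType dXi) (P : probability Xi R).
Context (phi : M -> Xi -> R) (X : set M).
Context (dO : measure_display) (Omega : measurableType dO) (Pr : probability Omega R).
Context (xi : nat -> nat -> Omega -> Xi) (x y : nat -> Omega -> M).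
Context (x0 : M) (K : nat) (b : nat -> nat) (eta : nat -> R).
Hypothesis run : SRFW P phi Exp Log X Pr xi x y x0 K b eta.
Implicit Types (k i j : nat) (w : Omega).

Lemma run_in k w : X x0 -> geodesically_convex Exp Log X ->
  (forall l, 0 <= eta l <= 1) -> (k <= K)%N -> X (x k w).
Proof.
move=> X0 gX e01; elim: k => [_|k IH kK]; first by rewrite (srfw_init run).
rewrite (srfw_step run) //; apply: gX => //; first exact: IH (ltnW kK).
by have [] := srfw_argmin run w kK.
Qed.

(** The history is generated by preimages of open sets; the sets whose preimage
    lies in it form a sigma-algebra, which thus contains the Borel sets. *)
Lemma history_preimage k j (A : set M) : (j <= k)%N ->
  measurable (A : set (borel M)) -> history xi x y b k (x j @^-1` A).
Proof.
move=> jk; rewrite /history; set G := (X in <<s X >>) => mA.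
suff : @measurable _ (borel M) `<=` [set A : set M | <<s G >> (x j @^-1` A)] by exact.
apply: smallest_sub.
  have [s0 sC sU] := smallest_sigma_algebra setT G.
  split => /=.
  - by rewrite preimage_set0.
  - move=> B hB; rewrite setTD.
    by have := sC _ hB; rewrite setTD.
  - by move=> F hF; rewrite preimage_bigcup; apply: sU.
by move=> U oU; apply: sub_gen_smallest; apply: Or31; exists j, U.
Qed.

Lemma history_setT k : history xi x y b k setT.
Proof.
have := @history_preimage k 0 setT isT; rewrite preimage_setT; apply.
exact: measurableT.
Qed.

Lemma fresh_sample k i (B : set Xi) : (k < K)%N -> (i < b k)%N ->
  measurable B -> Pr (xi k i @^-1` B) = P B.
Proof.
move=> kK ib mB; pose Bs l := if l == i then B else setT.
have mBs l : measurable (Bs l) by rewrite /Bs; case: ifP => // _; exact: measurableT.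
have := srfw_sample_fresh run kK (@history_setT k) mBs.
have -> : setT `&` \bigcap_(l < b k) (xi k l @^-1` Bs l) = xi k i @^-1` B.
  rewrite setTI; apply/seteqP; split => w /=.
    by move=> /(_ i ib); rewrite /Bs eqxx.
  by move=> Bi l _; rewrite /Bs /=; case: eqP => [->//|_].
have -> : \prod_(l < b k) fine (P (Bs l)) = fine (P B).
  rewrite (bigD1 (Ordinal ib)) //= big1 ?mulr1; last first.
    move=> l li; rewrite /Bs; have -> : (l == i :> nat) = false by apply/negbTE.
    by rewrite probability_setT.
  by rewrite /Bs eqxx.
have mE : measurable (xi k i @^-1` B).
  by rewrite -[X in measurable X]setTI; apply: (srfw_sample_measurable run kK ib).
rewrite probability_setT mul1r => h; have := congr1 EFin h.
by rewrite !fineK //; exact: fin_num_measure.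
Qed.

Lemma fresh_pair k i j (A : set Omega) (B B' : set Xi) : (k < K)%N ->
  (i < b k)%N -> (j < b k)%N -> i != j -> history xi x y b k A ->
  measurable A -> measurable B -> measurable B' ->
  Pr (A `&` (xi k i @^-1` B `&` xi k j @^-1` B')) = (Pr A * (P B * P B'))%E.
Proof.
move=> kK ib jb ij hA mA mB mB'.
pose Bs l := if l == i then B else if l == j then B' else setT.
have mBs l : measurable (Bs l).
  by rewrite /Bs; case: ifP => // _; case: ifP => // _; exact: measurableT.
have := srfw_sample_fresh run kK hA mBs.
have -> : \bigcap_(l < b k) (xi k l @^-1` Bs l) = xi k i @^-1` B `&` xi k j @^-1` B'.
  apply/seteqP; split => w /=.
    move=> H; split.
      by have := H i ib; rewrite /Bs eqxx.
    by have := H j jb; rewrite /Bs eq_sym (negPf ij) eqxx.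
  by move=> [Bi Bj] l lb; rewrite /Bs /=; case: eqP => [->//|_]; case: eqP => [->//|_].
have -> : \prod_(l < b k) fine (P (Bs l)) = fine (P B) * fine (P B').
  rewrite (bigD1 (Ordinal ib)) //= (bigD1 (Ordinal jb)) /=; last first.
    by rewrite -val_eqE /= eq_sym.
  rewrite big1 ?mulr1; last first.
    move=> l /andP[li lj]; rewrite /Bs.
    have -> : (l == i :> nat) = false by apply/negbTE.
    have -> : (l == j :> nat) = false by apply/negbTE.
    by rewrite probability_setT.
  by rewrite /Bs eqxx eq_sym (negPf ij) eqxx.
have mE : measurable (A `&` (xi k i @^-1` B `&` xi k j @^-1` B')).
  apply: measurableI => //; apply: measurableI.
    by rewrite -[X in measurable X]setTI; apply: (srfw_sample_measurable run kK ib).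
  by rewrite -[X in measurable X]setTI; apply: (srfw_sample_measurable run kK jb).
move=> h; have := congr1 EFin h; rewrite !EFinM !fineK //; exact: fin_num_measure.
Qed.

End Run.

Section RunNoise.
Context (R : realType) (n : nat) (M : riemannian_manifold R n).
Context (Exp : M -> 'rV[R]_n -> M) (Log : M -> M -> 'rV[R]_n).
Context (dXi : measure_display) (Xi : measurableType dXi) (P : probability Xi R).
Context (phi : M -> Xi -> R) (hphi : stochastic_objective P phi).
Hypothesis hunb : unbiased P phi.
Notation Phi := (objective P phi).
Hypothesis hdiff : forall x : M, mdifferentiable Phi x.
Context (supp : set Xi) (hsupp : measurable supp) (hsupp1 : P supp = 1%E).
Context (X : set M) (cX : compact X) (C : R).
Hypothesis hC : forall x z, X x -> supp z -> tnorm x (stoch_grad phi x z) <= C.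
Context (dO : measure_display) (Omega : measurableType dO) (Pr : probability Omega R).
Context (xi : nat -> nat -> Omega -> Xi) (x y : nat -> Omega -> M).
Context (x0 : M) (K : nat) (b : nat -> nat) (eta : nat -> R).
Hypothesis run : SRFW P phi Exp Log X Pr xi x y x0 K b eta.
Implicit Types (k i j : nat) (w : Omega).

Definition run_correlation k i j w : R :=
  correlation P phi supp X ((x k w, xi k i w), xi k j w).

Lemma run_preimage_sample k i (B : set Xi) : (k < K)%N -> (i < b k)%N ->
  measurable B -> measurable (xi k i @^-1` B).
Proof.
move=> kK ib mB; rewrite -[X in measurable X]setTI.
exact: (srfw_sample_measurable run kK ib).
Qed.

Lemma run_correlation_integrable k i j : (k < K)%N -> (i < b k)%N -> (j < b k)%N ->
  Pr.-integrable setT (EFin \o run_correlation k i j).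
Proof.
move=> kK ib jb; apply: (@bounded_integrable _ _ _ _ _ ((2 * C) ^+ 2)); last first.
  by move=> w; exact: (correlation_bound hunb hsupp hsupp1 hC).
have mx := srfw_x_measurable run (ltnW kK).
have mi := srfw_sample_measurable run kK ib.
have mj := srfw_sample_measurable run kK jb.
have mq : measurable_fun setT (fun w => (((x k w : borel M), xi k i w), xi k j w)).
  by apply: measurable_fun_pair => //; exact: measurable_fun_pair.
exact: (measurableT_comp (measurable_correlation hphi hdiff hsupp cX) mq).
Qed.

(** Distinct samples of one minibatch are independent of each other and of the
    iterate, so integrating over the second sample alone gives zero. *)
Lemma run_correlation_cross k i j : (k < K)%N -> (i < b k)%N -> (j < b k)%N ->
  i != j -> \int[Pr]_w run_correlation k i j w = 0.
Proof.
move=> kK ib jb ij; apply: EFin_inj.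
rewrite EFin_Rintegral; last exact: run_correlation_integrable.
have mx := srfw_x_measurable run (ltnW kK).
have mi := srfw_sample_measurable run kK ib.
have mj := srfw_sample_measurable run kK jb.
pose U w : borel M * Xi := ((x k w : borel M), xi k i w).
have mU : measurable_fun setT U by exact: measurable_fun_pair.
have mxA (A : set M) : measurable (A : set (borel M)) -> measurable (x k @^-1` A).
  by move=> mA; rewrite -[X in measurable X]setTI; exact: mx.
have fr (A : set M) (B B' : set Xi) :
    measurable (A : set (borel M)) -> measurable B -> measurable B' ->
    Pr (x k @^-1` A `&` (xi k i @^-1` B `&` xi k j @^-1` B')) =
    (Pr (x k @^-1` A) * (P B * P B'))%E.
  move=> mA mB mB'; apply: (fresh_pair run) => //; last exact: mxA.
  exact: history_preimage.
have frj B' : measurable B' -> Pr (xi k j @^-1` B') = P B'.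
  exact: (fresh_sample run).
have fri (A : set M) (B : set Xi) :
    measurable (A : set (borel M)) -> measurable B ->
    Pr (x k @^-1` A `&` xi k i @^-1` B) = (Pr (x k @^-1` A) * P B)%E.
  move=> mA mB; have := fr A B setT mA mB measurableT.
  by rewrite !preimage_setT !setIT !probability_setT !mule1.
have ind A B : measurable A -> measurable B ->
    Pr (U @^-1` A `&` xi k j @^-1` B) = (Pr (U @^-1` A) * P B)%E.
  move=> mA mB; rewrite -(frj _ mB).
  move: A mA; apply: (@independent_generated _ _ _ Pr _ _ U
    [set A1 `*` A2 | A1 in measurable & A2 in measurable]) => //.
  - exact: run_preimage_sample.
  - exact: measurable_prod_measurableType.
  - move=> _ _ [A1 mA1 [A2 mA2 <-]] [B1 mB1 [B2 mB2 <-]].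
    exists (A1 `&` B1); first exact: measurableI.
    by exists (A2 `&` B2); [exact: measurableI|rewrite setXI].
  move=> _ [A1 mA1 [A2 mA2 <-]].
  have -> : U @^-1` (A1 `*` A2) = x k @^-1` A1 `&` xi k i @^-1` A2 by [].
  rewrite -setIA; etransitivity; first exact: fr.
  by rewrite fri // frj // muleA.
transitivity (\int[Pr]_w \int[P]_z (correlation P phi supp X (U w, z))%:E)%E.
  apply: (@integral_independent _ _ _ _ _ _ _ _ _ U _ mU mj ind _ ((2 * C) ^+ 2)).
    exact: (measurable_correlation hphi hdiff hsupp cX).
  exact: (correlation_bound hunb hsupp hsupp1 hC).
apply: integral0_eq => w _.
exact: (correlation_mean hphi hunb hdiff hsupp hsupp1 cX hC).
Qed.

(** The cross terms vanish in mean, so the mean squared norm of the sum grows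
    linearly in the size of the minibatch. *)
Lemma minibatch_variance k : (k < K)%N ->
  Pr.-integrable setT
    (EFin \o (fun w => \sum_(i < b k) \sum_(j < b k) run_correlation k i j w)) /\
  \int[Pr]_w (\sum_(i < b k) \sum_(j < b k) run_correlation k i j w)
    <= (b k)%:R * (2 * C) ^+ 2.
Proof.
move=> kK.
have H (i : 'I_(b k)) := Rintegral_sum (fun j : 'I_(b k) =>
  run_correlation_integrable kK (ltn_ord i) (ltn_ord j)).
have [iS ->] := Rintegral_sum (fun i : 'I_(b k) => (H i).1).
split => //.
rewrite (le_trans (y := \sum_(i < b k) (2 * C) ^+ 2)) //; last first.
  by rewrite sumr_const card_ord -[X in X <= _]mulr_natl.
apply: ler_sum => i _; rewrite (H i).2 (bigD1 i) //= big1 ?addr0; last first.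
  by move=> j ji; apply: run_correlation_cross => //; rewrite eq_sym.
rewrite -lee_fin EFin_Rintegral; last exact: run_correlation_integrable.
rewrite -(probability_integral_cst Pr ((2 * C) ^+ 2)).
apply: le_integral => //.
- exact: run_correlation_integrable.
- by apply: (@bounded_integrable _ _ _ _ (cst ((2 * C) ^+ 2)) `|(2 * C) ^+ 2|).
move=> w _; rewrite lee_fin (le_trans (ler_norm _)) //.
exact: (correlation_bound hunb hsupp hsupp1 hC).
Qed.

(** Each sample leaves the support with probability zero, and countably many null
    sets have a null union. *)
Lemma samples_in_supp : exists N : set Omega, [/\ measurable N, Pr N = 0%E &
  forall w, ~ N w -> forall k i, (k < K)%N -> (i < b k)%N -> supp (xi k i w)].
Proof.
pose B k i := if (k < K)%N && (i < b k)%N then xi k i @^-1` (~` supp) else set0.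
have mB k i : measurable (B k i).
  rewrite /B; case: ifP => // /andP[kK ib]; apply: run_preimage_sample => //.
  exact: measurableC.
have B0 k i : Pr (B k i) = 0%E.
  rewrite /B; case: ifP => [/andP[kK ib]|_]; last exact: measure0.
  rewrite (fresh_sample run) //; last exact: measurableC.
  by rewrite probability_setC // hsupp1 subee.
have mBk k : measurable (\bigcup_i B k i) by exact: bigcup_measurable.
have mN : measurable (\bigcup_k \bigcup_i B k i) by exact: bigcup_measurable.
exists (\bigcup_k \bigcup_i B k i); split => //.
  apply: measure_negligible => //; apply: negligible_bigcup => k.
  apply: negligible_bigcup => i; apply/negligibleP => //; exact: B0.
move=> w Nw k i kK ib; apply: contrapT => ns; apply: Nw.
by exists k => //; exists i => //; rewrite /B kK ib.
Qed.

Lemma minibatch_noise k w : (0 < b k)%N ->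
  minibatch_grad phi xi x b k w - grad Phi (x k w) =
  (b k)%:R^-1 *: \sum_(i < b k) noise P phi (x k w) (xi k i w).
Proof.
move=> b0; rewrite /noise sumrB sumr_const card_ord scalerBr.
rewrite -[grad _ _ *+ _]scaler_nat scalerA.
by rewrite mulVf ?scale1r // pnatr_eq0 -lt0n.
Qed.

Lemma sqr_minibatch_noise k w : (0 < b k)%N -> X (x k w) ->
  (forall i, (i < b k)%N -> supp (xi k i w)) ->
  tnorm (x k w) (minibatch_grad phi xi x b k w - grad Phi (x k w)) ^+ 2 =
  (b k)%:R^-1 ^+ 2 * \sum_(i < b k) \sum_(j < b k) run_correlation k i j w.
Proof.
move=> b0 Xx ss; rewrite sqr_tnorm minibatch_noise // innerZl innerZr mulrA -expr2.
congr (_ * _).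
have sl v (F : 'I_(b k) -> 'rV[R]_n) :
    inner (x k w) (\sum_i F i) v = \sum_i inner (x k w) (F i) v.
  elim/big_rec2: _ => [|i a c _ <-]; [exact: inner0l|exact: innerDl].
rewrite sl; apply: eq_bigr => i _; rewrite innerC sl; apply: eq_bigr => j _.
by rewrite innerC /run_correlation correlationE //; exact: ss.
Qed.

End RunNoise.

(** * The expected gap of the output *)

Section Output.
Context (R : realType) (n : nat) (M : riemannian_manifold R n).
Context (Exp : M -> 'rV[R]_n -> M) (Log : M -> M -> 'rV[R]_n).
Context (dXi : measure_display) (Xi : measurableType dXi) (P : probability Xi R).
Context (phi : M -> Xi -> R) (X : set M).
Context (dO : measure_display) (Omega : measurableType dO) (Pr : probability Omega R).
Context (xi : nat -> nat -> Omega -> Xi) (x y : nat -> Omega -> M).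
Context (x0 : M) (K : nat) (b : nat -> nat) (eta : nat -> R).
Hypothesis run : SRFW P phi Exp Log X Pr xi x y x0 K b eta.

(** Split according to the value of the index, which has probability 1 / K and is
    independent of each iterate. *)
Lemma uniform_output_mean (xhat : Omega -> M) (f : M -> R) (c : R) :
  uniform_output Pr xi x y K b xhat ->
  measurable_fun setT (f : borel M -> R) -> (forall u, `|f u| <= c) ->
  Pr.-integrable setT (EFin \o (fun w => f (xhat w))) /\
  \int[Pr]_w f (xhat w) = K%:R^-1 * \sum_(j < K) \int[Pr]_w f (x j w).
Proof.
move=> [kappa [mk ik xk]] mf fc.
pose D (j : 'I_K) : set Omega := kappa @^-1` [set j].
have E : (fun w => f (xhat w)) = (fun w => \sum_(j < K) \1_(D j) w * f (x j w)).
  apply/funext => w; rewrite xk (bigD1 (kappa w)) //= big1 ?addr0.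
    by rewrite indicE mem_set // mul1r.
  by move=> j jk; rewrite indicE memNset ?mul0r // => /= e; rewrite e eqxx in jk.
have mx (j : 'I_K) := srfw_x_measurable run (ltnW (ltn_ord j)).
have mfx (j : 'I_K) : measurable_fun setT (fun w => f (x j w)).
  exact: (measurableT_comp mf (mx j)).
have iD j : Pr.-integrable setT (EFin \o (fun w => \1_(D j) w * f (x j w))).
  apply: (@bounded_integrable _ _ _ _ _ c).
    apply: measurable_funM; last exact: mfx.
    exact: (measurable_indic (mk j)).
  move=> w; rewrite normrM indicE; case: (w \in D j).
    by rewrite normr1 mul1r.
  by rewrite normr0 mul0r (le_trans _ (fc (x j w))).
have [iS eS] := Rintegral_sum iD.
rewrite E; split => //; rewrite eS mulr_sumr; apply: eq_bigr => j _.
apply: (@Rintegral_independent_event _ _ _ _ _ _ (x j : Omega -> borel M) (D j)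
  (K%:R^-1) (f : borel M -> R) c) => //.
- exact: mk.
move=> A mA.
have mE : measurable (x j @^-1` A) by rewrite -[X in measurable X]setTI; exact: mx.
have hA : history xi x y b K (x j @^-1` A).
  by apply: history_preimage mA; exact/ltnW.
have h := ik j _ hA; have := congr1 EFin h.
rewrite EFinM !fineK //; apply: fin_num_measure => //; exact: measurableI.
Qed.

End Output.

Unset Implicit Arguments.

Theorem corollary3p8 (R : realType) (n : nat) (M : riemannian_manifold R n)
  (Exp : M -> 'rV[R]_n -> M) (Log : M -> M -> 'rV[R]_n)
  (Tr : M -> M -> 'rV[R]_n -> 'rV[R]_n)
  (hExp : exponential_map Exp) (hLog : inverse_exponential Exp Log)
  (hTr : parallel_transport Exp Log Tr)
  (X : set M) (hXc : compact X) (hXg : geodesically_convex Exp Log X)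
  (dXi : measure_display) (Xi : measurableType dXi) (P : probability Xi R)
  (phi : M -> Xi -> R) (hphi : stochastic_objective P phi)
  (hunb : unbiased P phi)
  (L : R) (hL : L_smooth Tr L (objective P phi))
  (hconv : g_convex Log (objective P phi))
  (supp : set Xi) (hsupp : measurable supp) (hsupp1 : P supp = 1%E)
  (C : R) (hC0 : 0 <= C)
  (hC : forall x z, X x -> supp z -> tnorm x (stoch_grad phi x z) <= C)
  (x0 : M) (hx0 : X x0) (xstar : M) (hxstar : argmin X (objective P phi) xstar) :
  exists A : R, forall (K : nat), (1 <= K)%N ->
  forall (dO : measure_display) (Omega : measurableType dO)
    (Pr : probability Omega R) (xi : nat -> nat -> Omega -> Xi)
    (x y : nat -> Omega -> M) (xhat : Omega -> M),
    SRFW P phi Exp Log X Pr xi x y x0 K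
      (fun=> K) (fun=> (Num.sqrt K%:R)^-1) ->
    uniform_output Pr xi x y K (fun=> K) xhat ->
    (`| 'E_Pr[fun w => (objective P phi (xhat w) - objective P phi xstar)%R] |
       <= (A / Num.sqrt K%:R)%:E)%E.
Proof.
have hdiff := hL.1; set Phi := objective P phi in hL hconv hxstar hdiff *.
have [Xs sX] := hxstar.
have [D D0 XD] := compact_diameter hExp hLog hXc.
have gC x : X x -> tnorm x (grad Phi x) <= C.
  exact: (objective_gradient_bound hunb hsupp hsupp1 hC).
have gap0 x : X x -> 0 <= Phi x - Phi xstar by move=> /sX; rewrite subr_ge0.
have gapC x : X x -> Phi x - Phi xstar <= C * D.
  by move=> Xx; apply: (gap_bound hLog hconv XD) => //; exact: gC.
(* the initial gap, the second-order remainders of the K steps, which add up to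
   a constant, and the variances of the minibatches *)
pose A := Phi x0 - Phi xstar + (D + `|L| * D ^+ 2) + D * (2 * C) ^+ 2.
exists A.
move=> K K1 dO Omega Pr xi x y xhat run out.
set s := Num.sqrt K%:R in run *.
have K0 : 0 < K%:R :> R by rewrite ltr0n.
have s0 : 0 < s by rewrite sqrtr_gt0.
have s2 : s ^+ 2 = K%:R by rewrite sqr_sqrtr // ltW.
have e2 : s^-1 ^+ 2 = K%:R^-1 by rewrite exprVn s2.
have e01 : 0 <= s^-1 <= 1.
  rewrite invr_ge0 ltW //= invf_le1 // /s -[X in X <= _]sqrtr1.
  by rewrite ler_wsqrtr // ler1n.
have e0 : 0 < s^-1 by rewrite invr_gt0.
have Xx k w : (k <= K)%N -> X (x k w) by exact: (run_in run w hx0 hXg (fun=> e01)).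
(* cut off outside X, where no iterate goes, to be bounded everywhere *)
pose gap : borel M -> R := (fun u => Phi u - Phi xstar) \_ (X : set (borel M)).
have gapE u : X u -> gap u = Phi u - Phi xstar by move=> Xu; rewrite /gap patchE mem_set.
have gap_ge0 u : 0 <= gap u.
  by rewrite /gap patchE; case: ifPn => //; rewrite inE => /gap0.
have gap_le u : `|gap u| <= C * D.
  rewrite ger0_norm // /gap patchE; case: ifPn => [|_]; first by rewrite inE => /gapC.
  exact: mulr_ge0.
have mgap : measurable_fun setT gap.
  apply/(measurable_restrictT _ (borel_compact hXc)); apply: measurable_funTS.
  by apply: measurable_funB; [exact: measurable_objective|exact: measurable_cst].
pose S k w := \sum_(i < K) \sum_(j < K) run_correlation P phi supp X xi x k i j w.
have var := minibatch_variance hphi hunb hdiff hsupp hsupp1 hXc hC run.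
have [N [mN N0 sN]] := samples_in_supp hsupp hsupp1 run.
have igap (k : 'I_K) : Pr.-integrable setT (EFin \o (fun w => s^-1 * gap (x k w))).
  apply: (@bounded_integrable _ _ _ _ _ (s^-1 * (C * D))).
    apply: measurable_funM; first exact: measurable_cst.
    exact: (measurableT_comp mgap (srfw_x_measurable run (ltnW (ltn_ord k)))).
  by move=> w; rewrite normrM gtr0_norm // ler_wpM2l // ltW.
(* samples in the support make the squared errors equal to correlations *)
have pw w : ~ N w -> \sum_(k < K) s^-1 * gap (x k w) <=
    (Phi x0 - Phi xstar + (D + `|L| * D ^+ 2))
     + \sum_(k < K) D * K%:R^-1 ^+ 2 * S k w.
  move=> Nw.
  have step (k : 'I_K) : s^-1 * gap (x k w) <= (Phi (x k w) - Phi (x k.+1 w))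
     + (D + `|L| * D ^+ 2) / K%:R + D * K%:R^-1 ^+ 2 * S k w.
    have kK := ltn_ord k; have Xk := Xx k w (ltnW kK).
    have [Xy my] := srfw_argmin run w kK.
    have := frank_wolfe_step hExp hLog hTr hL hconv D0 XD Xk Xy Xs e01 (my _ Xs).
    rewrite -(srfw_step run) // gapE //.
    have := @sqr_minibatch_noise _ _ _ _ _ P phi supp X _ _ xi x (fun=> K) k w K1 Xk.
    move=> /(_ (fun i iK => sN w Nw k i kK iK)).
    rewrite -/(S k w); set d := tnorm _ _ => dE.
    (* 2 * a * d <= a ^ 2 + d ^ 2 for the step size a, whose square is 1 / K *)
    have d2 : s^-1 * (2 * D * d) <= D * (K%:R^-1 + K%:R^-1 ^+ 2 * S k w).
      rewrite -dE -e2; have := sqr_ge0 (s^-1 - d); nra.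
    rewrite exprMn e2; lra.
  apply: le_trans (ler_sum _ (fun k _ => step k)) _.
  rewrite big_split /= big_split /= sumr_const card_ord -[_ *+ K]mulr_natr.
  rewrite divfK ?lt0r_neq0 //.
  rewrite lerD2r lerD2r.
  have -> : \sum_(k < K) (Phi (x k w) - Phi (x k.+1 w)) = Phi x0 - Phi (x K w).
    rewrite -(big_mkord xpredT (fun k => Phi (x k w) - Phi (x k.+1 w))).
    rewrite (telescope_sumr_eq (fun k => - Phi (x k w))) //.
      by rewrite (srfw_init run) opprK addrC.
    by move=> k _; rewrite opprK addrC.
  by rewrite lerD2l lerN2; apply: sX; exact: Xx.
have [iL eL] := Rintegral_sum igap.
have iS (k : 'I_K) : Pr.-integrable setT (EFin \o (fun w => D * K%:R^-1 ^+ 2 * S k w)).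
  have := integrableZl measurableT (D * K%:R^-1 ^+ 2) (var k (ltn_ord k)).1.
  by apply: eq_integrable.
have [iR eR] := Rintegral_sum iS.
pose c0 := Phi x0 - Phi xstar + (D + `|L| * D ^+ 2).
have ic : Pr.-integrable setT (EFin \o cst c0).
  exact: (@bounded_integrable _ _ _ _ (cst c0) `|c0|).
have ir : Pr.-integrable setT (EFin \o
    (fun w => c0 + \sum_(k < K) D * K%:R^-1 ^+ 2 * S k w)).
  exact: (integrableD measurableT ic iR).
have le1 := Rintegral_ae_le iL ir mN N0 pw.
have sum_gap : s^-1 * \sum_(k < K) \int[Pr]_w gap (x k w) <= A.
  have -> : s^-1 * \sum_(k < K) \int[Pr]_w gap (x k w) =
      \int[Pr]_w (\sum_(k < K) s^-1 * gap (x k w)).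
    rewrite eL mulr_sumr; apply: eq_bigr => k _; rewrite RintegralZl //.
    apply: (@bounded_integrable _ _ _ _ _ (C * D)); last by move=> w; exact: gap_le.
    exact: (measurableT_comp mgap (srfw_x_measurable run (ltnW (ltn_ord k)))).
  apply: le_trans le1 _.
  rewrite (RintegralD measurableT ic iR) eR.
  have -> : \int[Pr]_w cst c0 w = c0.
    by apply: EFin_inj; rewrite EFin_Rintegral // probability_integral_cst.
  rewrite lerD2l.
  have Sk (k : 'I_K) : \int[Pr]_w (D * K%:R^-1 ^+ 2 * S k w) <= D * (2 * C) ^+ 2 / K%:R.
    have [iv ev] := var k (ltn_ord k); rewrite RintegralZl //.
    have -> : D * (2 * C) ^+ 2 / K%:R = D * K%:R^-1 ^+ 2 * (K%:R * (2 * C) ^+ 2).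
      by field; rewrite lt0r_neq0.
    by rewrite ler_wpM2l // mulr_ge0 // sqr_ge0.
  apply: le_trans (ler_sum _ (fun k _ => Sk k)) _.
  by rewrite sumr_const card_ord -[_ *+ K]mulr_natr divfK ?lt0r_neq0.
have [ih eh] := uniform_output_mean run out mgap gap_le.
have xhatX w : X (xhat w).
  by have [kappa [_ _ ->]] := out; apply: Xx; exact/ltnW.
have -> : ('E_Pr[fun w => (Phi (xhat w) - Phi xstar)%R] =
    (\int[Pr]_w gap (xhat w))%:E)%E.
  rewrite unlock EFin_Rintegral //; apply: eq_integral => w _.
  by rewrite gapE.
rewrite abse_EFin lee_fin ger0_norm; last exact: Rintegral_ge0.
by rewrite eh -e2 expr2 -mulrA [leRHS]mulrC ler_wpM2l // ltW.
Qed.
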